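(* HerFO is not coNP-rich, unless $\mathrm E=\mathrm{NE}$.
   Context: All signatures are finite and relational, and all structures have non-empty domains. For a first-order $\tau$-sentence $\phi$, $\mathrm{Her}(\phi)$ is the class of finite $\tau$-structures $\mathbb A$ such that all non-empty (induced) substructures of $\mathbb A$ satisfy $\phi$, viewed as a decision problem on finite $\tau$-structures. HerFO is the collection of all problems of the form $\mathrm{Her}(\phi)$ with $\phi$ a first-order sentence. A class $\mathcal K$ of problems is coNP-rich if every problem in coNP is polynomial-time equivalent (there are polynomial-time many-one reductions in both directions) to some problem in $\mathcal K$. $\mathrm E$ is the class of problems decidable in deterministic time $2^{O(n)}$, and $\mathrm{NE}$ its nondeterministic counterpart. *)

(* Defs.v *)
(* Built on MathComp. *)
From HB Require Import structures.
From mathcomp Require Import all_boot.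

Set Implicit Arguments.
Unset Strict Implicit.
Unset Printing Implicit Defensive.

(** * Turing machines *)

Definition word := seq bool.

(* Tape symbols: the blank [None], the bits [Some (inl b)], and finitely many
   auxiliary symbols [Some (inr a)]. *)
Definition symbol (X : finType) := option (bool + X).

(* A two-way infinite tape with finitely many non-blank cells. [cells_left]
   lists the cells to the left of the head, nearest first; [cells_right] starts
   with the scanned cell. All cells not listed are blank. *)
Record tape (X : finType) := Tape {
  cells_left : seq (symbol X);
  cells_right : seq (symbol X)
}.

Definition scan (X : finType) (t : tape X) : symbol X :=
  head None (cells_right t).

(* Head movement: [Some true] is right, [Some false] is left, [None] is stay. *)
Definition move := option bool.

Definition update (X : finType) (a : symbol X) (m : move) (t : tape X) :
    tape X :=
  let l := cells_left t in
  let r := behead (cells_right t) in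
  match m with
  | None => Tape l (a :: r)
  | Some true => Tape (a :: l) r
  | Some false => Tape (behead l) [:: head None l, a & r]
  end.

(* Nondeterministic multitape machines. The finite set [tape_index] names the
   tapes; [io] is the tape that holds the input and the output. The machine
   halts exactly when [trans] offers no action. *)
Record machine := Machine {
  state : finType;
  aux : finType;
  tape_index : finType;
  io : tape_index;
  start : state;
  accepting : pred state;
  trans : state -> {ffun tape_index -> symbol aux} ->
          {set state * {ffun tape_index -> symbol aux * move}}
}.

Definition deterministic (M : machine) : Prop :=
  forall (q : state M) (s : {ffun tape_index M -> symbol (aux M)}),
    #|trans q s| <= 1.

Record config (M : machine) := Config {
  cstate : state M;
  ctapes : {ffun tape_index M -> tape (aux M)}
}.

Definition scanned (M : machine) (c : config M) :
    {ffun tape_index M -> symbol (aux M)} :=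
  [ffun i => scan (ctapes c i)].

Definition actions (M : machine) (c : config M) :=
  trans (cstate c) (scanned c).

Definition halted (M : machine) (c : config M) : Prop := actions c = set0.

Definition step (M : machine) (c c' : config M) : Prop :=
  exists2 a, a \in actions c &
    c' = Config a.1 [ffun i => update (a.2 i).1 (a.2 i).2 (ctapes c i)].

Fixpoint run (M : machine) (n : nat) (c c' : config M) : Prop :=
  match n with
  | 0 => c = c'
  | m.+1 => exists2 c1, step c c1 & run m c1 c'
  end.

Definition init (M : machine) (w : word) : config M :=
  Config (start M)
    [ffun i => Tape [::] (if i == io M then [seq Some (inl b) | b <- w]
                          else [::])].

(* The maximal block of bits starting at the head of the [io] tape. *)
Fixpoint leading_bits (X : finType) (s : seq (symbol X)) : word :=
  match s with
  | Some (inl b) :: s' => b :: leading_bits s'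
  | _ => [::]
  end.

Definition output (M : machine) (c : config M) : word :=
  leading_bits (cells_right (ctapes c (io M))).

(** * Complexity classes *)

Definition language := word -> Prop.

Definition decides_in_time (M : machine) (t : nat -> nat) (L : language) :
    Prop :=
  forall w : word,
    (forall n (c : config M), run n (init M w) c -> n <= t (size w)) /\
    (L w <->
     exists n (c : config M),
       [/\ run n (init M w) c, halted c & accepting (cstate c)]).

Definition DTIME (t : nat -> nat) (L : language) : Prop :=
  exists2 M : machine, deterministic M & decides_in_time M t L.

Definition NTIME (t : nat -> nat) (L : language) : Prop :=
  exists M : machine, decides_in_time M t L.

(* Every polynomial in [n] is at most [poly_bound c n] for some [c]. *)
Definition poly_bound (c n : nat) : nat := n ^ c + c.

Definition exp_bound (c n : nat) : nat := 2 ^ (c * n + c).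

Definition in_NP (L : language) : Prop := exists c, NTIME (poly_bound c) L.
Definition in_coNP (L : language) : Prop := in_NP (fun w => ~ L w).
Definition in_E (L : language) : Prop := exists c, DTIME (exp_bound c) L.
Definition in_NE (L : language) : Prop := exists c, NTIME (exp_bound c) L.

(** * Decision problems and reductions *)

(* A decision problem carries its own type of instances, so that words which
   encode no instance are neither yes- nor no-instances. *)
Record problem := Problem {
  instance : Type;
  encode : instance -> word;
  yes : instance -> Prop
}.

Definition language_problem (L : language) : problem :=
  @Problem word id L.

Definition computes_in_time (M : machine) (t : nat -> nat) (P Q : problem)
    (f : instance P -> instance Q) : Prop :=
  forall x : instance P,
    exists n (c : config M),
      [/\ n <= t (size (encode x)), run n (init M (encode x)) c, halted c
        & output c = encode (f x)].

Definition poly_time (P Q : problem) (f : instance P -> instance Q) : Prop :=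
  exists M : machine, deterministic M /\
    exists c, computes_in_time M (poly_bound c) f.

Definition poly_reducible (P Q : problem) : Prop :=
  exists f : instance P -> instance Q,
    poly_time f /\ forall x, yes x <-> yes (f x).

Definition poly_equivalent (P Q : problem) : Prop :=
  poly_reducible P Q /\ poly_reducible Q P.

Definition coNP_rich (K : problem -> Prop) : Prop :=
  forall L : language, in_coNP L ->
    exists2 P, K P & poly_equivalent (language_problem L) P.

(** * Finite relational structures *)

Record signature := Signature {
  rel_symbol :> finType;
  arity : rel_symbol -> nat
}.

Record structure (tau : signature) := Structure {
  domain :> finType;
  domain_nonempty : 0 < #|domain|;
  interp : forall R : tau, (arity R).-tuple domain -> bool
}.

Lemma card_induced (T : finType) (S : {set T}) :
  S != set0 -> 0 < #|{: {x : T | x \in S}}|.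
Proof. by rewrite card_sig -card_gt0. Qed.

Definition substructure (tau : signature) (A : structure tau) (S : {set A})
    (S_nonempty : S != set0) : structure tau :=
  @Structure tau {x : A | x \in S} (card_induced S_nonempty)
    (fun R t => interp (map_tuple val t)).

(* All [k]-tuples, in lexicographic order for the order of [enum T]. *)
Fixpoint all_tuples (T : finType) (k : nat) : seq (k.-tuple T) :=
  match k with
  | 0 => [:: [tuple]]
  | k'.+1 => [seq cons_tuple x t | x <- enum T, t <- all_tuples T k']
  end.

(* The size of the domain in unary, ended by [false], then the table of each
   relation. *)
Definition encode_structure (tau : signature) (A : structure tau) : word :=
  nseq #|A| true ++ false ::
  flatten [seq [seq interp t | t <- all_tuples A (arity R)] | R <- enum tau].

(** * First-order logic and hereditary model checking *)

(* [formula tau n] consists of the first-order formulas with equality whose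
   free variables are among the [n] variables ['I_n]. A quantifier binds
   [ord0] and renames every other variable [j] to [lift ord0 j]. *)
Inductive formula (tau : signature) : nat -> Type :=
| FFalse n : formula tau n
| FEq n (i j : 'I_n) : formula tau n
| FRel n (R : tau) (v : (arity R).-tuple 'I_n) : formula tau n
| FNot n (phi : formula tau n) : formula tau n
| FAnd n (phi psi : formula tau n) : formula tau n
| FOr n (phi psi : formula tau n) : formula tau n
| FEx n (phi : formula tau n.+1) : formula tau n
| FAll n (phi : formula tau n.+1) : formula tau n.

Definition sentence (tau : signature) := formula tau 0.

Definition extend (T : Type) n (x : T) (e : 'I_n -> T) : 'I_n.+1 -> T :=
  fun i => oapp e x (unlift ord0 i).

Fixpoint sat (tau : signature) (A : structure tau) n (phi : formula tau n) :
    ('I_n -> A) -> bool :=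
  match phi in formula _ n return ('I_n -> A) -> bool with
  | FFalse _ => fun _ => false
  | FEq _ i j => fun e => e i == e j
  | FRel _ R v => fun e => interp (map_tuple e v)
  | FNot _ psi => fun e => ~~ sat psi e
  | FAnd _ psi chi => fun e => sat psi e && sat chi e
  | FOr _ psi chi => fun e => sat psi e || sat chi e
  | FEx _ psi => fun e => [exists x : A, sat psi (extend x e)]
  | FAll _ psi => fun e => [forall x : A, sat psi (extend x e)]
  end.

Definition models (tau : signature) (A : structure tau) (phi : sentence tau) :
    Prop :=
  forall e : 'I_0 -> A, sat phi e.

Definition hereditarily_models (tau : signature) (phi : sentence tau)
    (A : structure tau) : Prop :=
  forall (S : {set A}) (S_nonempty : S != set0),
    models (substructure S_nonempty) phi.

Definition Her (tau : signature) (phi : sentence tau) : problem :=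
  Problem (@encode_structure tau) (hereditarily_models phi).

Definition HerFO (P : problem) : Prop :=
  exists (tau : signature) (phi : sentence tau), P = Her phi.

(* Main.v *)
Require Import Defs.
From mathcomp Require Import all_boot.
From mathcomp Require Import zify.
From Stdlib Require Import Classical.

Set Implicit Arguments.
Unset Strict Implicit.
Unset Printing Implicit Defensive.

(** Suppose that HerFO is coNP-rich and let [L] be in NE. Number the words by
    bijective binary numeration and let [T] consist of the words whose length is
    the number of a word of [L]. Lengths are exponential in the words that they
    number, so [T] is in NP ([tally_in_NP]) and its complement [K] is in coNP.
    By richness there are polynomial-time reductions [f] from [K] to some
    Her(phi) and [g] back. It suffices to decide Her(phi), hence [K], in
    polynomial time: replacing a word by a tally of exponential length then
    decides [L] in time 2^O(n) ([in_E_of_poly]).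

    Her(phi) is self-reducible: a structure belongs to it iff it satisfies phi
    and all its substructures with one element less belong to it
    ([hereditarily_models_step]). Unfolding this level by level meets
    exponentially many substructures, but [g] maps them to words of polynomial
    length, and since [K] only looks at lengths, membership of a structure [B]
    is determined by the length of [g B]. Keeping one structure for each length
    therefore loses nothing ([search_complete]) and leaves polynomially many on
    each level ([poly_search]). This is Berman's argument that tally sets
    cannot be hard for NP unless P = NP, applied to conjunctive
    self-reductions.

    The algorithms are assembled from closure properties of a class of
    polynomial-time functions: values are coded by binary trees, kept in
    preorder on a stack, and manipulated by small programs on four stacks
    ([poly_pair], [poly_match], [poly_foldl]). The reductions, given by Turing
    machines, enter this class because a step of a machine is such a function
    and can be iterated ([poly_of_machine]). In the other direction a stack
    program followed by a machine is again a machine ([prog_then_decides]);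
    this is applied to a nondeterministic machine for [tally_in_NP] and to a
    machine that only reads one bit for [in_E_of_poly]. *)

(** * Stack programs and their compilation *)

Inductive register := Main | RegA | RegB | RegC.

(** Entries are optional bits because a stack shows a blank between [Grow] and
    [Put]. *)
Record store := Store {
  main : seq (option bool);
  reg_a : seq (option bool);
  reg_b : seq (option bool);
  reg_c : seq (option bool)
}.

Definition stack (s : store) (i : register) : seq (option bool) :=
  match i with
  | Main => main s | RegA => reg_a s | RegB => reg_b s | RegC => reg_c s
  end.

Definition set_stack (i : register) (x : seq (option bool)) (s : store) :=
  let: Store m a b c := s in
  match i with
  | Main => Store x a b c
  | RegA => Store m x b c
  | RegB => Store m a x c
  | RegC => Store m a b x
  end.

Definition top (s : store) (i : register) : option bool := head None (stack s i).

(** Each primitive is a single step of a machine: [Grow] moves the head to a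
    blank cell on the left, and a bit is pushed by [Grow] followed by [Put]. *)
Inductive prim := Grow | Put of bool | Erase.

Definition apply_prim (o : prim) (x : seq (option bool)) :=
  match o with
  | Grow => None :: x
  | Put b => Some b :: behead x
  | Erase => behead x
  end.

Inductive prog :=
| Do of register & prim
| Seq of prog & prog
| If of register & pred (option bool) & prog & prog
| While of register & pred (option bool) & prog.

(** The number counts machine steps, one for each primitive and for each test. *)
Inductive exec : prog -> store -> nat -> store -> Prop :=
| ExecDo i o s : exec (Do i o) s 1 (set_stack i (apply_prim o (stack s i)) s)
| ExecSeq p q s n s1 m s2 :
    exec p s n s1 -> exec q s1 m s2 -> exec (Seq p q) s (n + m) s2
| ExecIf i c p q s n s' :
    exec (if c (top s i) then p else q) s n s' -> exec (If i c p q) s n.+1 s'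
| ExecStop i (c : pred (option bool)) p s :
    ~~ c (top s i) -> exec (While i c p) s 1 s
| ExecLoop i (c : pred (option bool)) p s n s1 m s2 :
    c (top s i) -> exec p s n s1 -> exec (While i c p) s1 m s2 ->
    exec (While i c p) s (n + m).+1 s2.

(** Control points of the compiled program. In a conditional or a loop, [None]
    is the point at which the test is made. *)
Fixpoint pos (p : prog) : finType :=
  match p with
  | Do _ _ => unit
  | Seq p q => (pos p + pos q)%type
  | If _ _ p q => option (pos p + pos q)
  | While _ _ p => option (pos p)
  end.

Fixpoint entry (p : prog) : pos p :=
  match p with
  | Do _ _ => tt
  | Seq p q => inl (entry p)
  | If _ _ p q => None
  | While _ _ p => None
  end.

(** The first component is [None] when the program is left. *)
Fixpoint next (p : prog) (t : register -> option bool) :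
    pos p -> option (pos p) * option (register * prim) :=
  match p return pos p -> option (pos p) * option (register * prim) with
  | Do i o => fun _ => (None, Some (i, o))
  | Seq p q => fun x => match x with
    | inl y => let: (z, e) := next t y in
               (Some (if z is Some z' then inl z' else inr (entry q)), e)
    | inr y => let: (z, e) := next t y in (omap inr z, e)
    end
  | If i c p q => fun x => match x with
    | None => (Some (Some (if c (t i) then inl (entry p) else inr (entry q))),
               None)
    | Some (inl y) => let: (z, e) := next t y in (omap (Some \o inl) z, e)
    | Some (inr y) => let: (z, e) := next t y in (omap (Some \o inr) z, e)
    end
  | While i c p => fun x => match x with
    | None => (if c (t i) then Some (Some (entry p)) else None, None)
    | Some y => let: (z, e) := next t y in (Some z, e)
    end
  end.

Lemma eq_next p t1 t2 (x : pos p) : t1 =1 t2 -> next t1 x = next t2 x.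
Proof.
move=> E; elim: p x => [//|p IHp q IHq|i c p IHp q IHq|i c p IHp] /=.
- by case=> x; rewrite ?IHp ?IHq.
- by case=> [[] x|]; rewrite ?IHp ?IHq ?E.
- by case=> [x|]; rewrite ?IHp ?E.
Qed.

Definition effect (e : option (register * prim)) (s : store) : store :=
  if e is Some (i, o) then set_stack i (apply_prim o (stack s i)) s else s.

Inductive path (p : prog) :
    option (pos p) -> store -> nat -> option (pos p) -> store -> Prop :=
| PathNil x s : path x s 0 x s
| PathCons x s n z s' :
    path (next (top s) x).1 (effect (next (top s) x).2 s) n z s' ->
    path (Some x) s n.+1 z s'.

Lemma path_trans p (x y z : option (pos p)) s1 s2 s3 n m :
  path x s1 n y s2 -> path y s2 m z s3 -> path x s1 (n + m) z s3.
Proof. by elim=> [//|x' s k w s' _ IH] /IH; exact: PathCons. Qed.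

(** A run of a subprogram becomes a run of the enclosing program in which the
    end of the subprogram is replaced by the point that follows it. *)
Section Lift.
Variables (p r : prog) (lift_pos : pos p -> pos r) (exit : option (pos r)).
Hypothesis next_lift : forall t x,
  next t (lift_pos x) =
  (if (next t x).1 is Some y then Some (lift_pos y) else exit, (next t x).2).

Lemma path_lift x s n s' :
  path (Some x) s n None s' -> path (Some (lift_pos x)) s n exit s'.
Proof.
pose F o := if o is Some y then Some (lift_pos y) else exit.
suff H o o' : path o s n o' s' -> path (F o) s n (F o') s' by move/H.
elim=> [z s1|z s1 k y s2 hp IH] {s n s'}; first exact: PathNil.
by apply: PathCons; rewrite next_lift.
Qed.
End Lift.

Lemma exec_path p s n s' :
  exec p s n s' -> path (Some (entry p)) s n None s'.
Proof.
elim=> {p s n s'}.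
- by move=> i o s; apply: PathCons; apply: PathNil.
- move=> p q s n s1 m s2 _ IH1 _ IH2; apply: path_trans.
    apply: (@path_lift p (Seq p q) inl (Some (inr (entry q)))) IH1 => t x /=.
    by case: (next t x) => [[y|] e].
  apply: (@path_lift q (Seq p q) inr None) IH2 => t x /=.
  by case: (next t x) => [[y|] e].
- move=> i c p q s n s' _ IH; apply: PathCons => /=.
  case: (c _) IH => IH.
    apply: (@path_lift p (If i c p q) (Some \o inl) None) IH => t x /=.
    by case: (next t x) => [[y|] e].
  apply: (@path_lift q (If i c p q) (Some \o inr) None) IH => t x /=.
  by case: (next t x) => [[y|] e].
- move=> i c p s /negbTE hc; apply: PathCons => /=; rewrite hc /=.
  exact: PathNil.
- move=> i c p s n s1 m s2 hc _ IH1 _ IH2; apply: PathCons => /=; rewrite hc /=.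
  apply: path_trans IH2.
  apply: (@path_lift p (While i c p) Some (Some None)) IH1 => t x /=.
  by case: (next t x) => [[y|] e].
Qed.

Section Symbols.
Variable X : finType.
Implicit Types (t u : tape X) (x : seq (option bool)).

Definition sym (o : option bool) : symbol X := omap inl o.
Definition read (a : symbol X) : option bool :=
  if a is Some (inl b) then Some b else None.

Lemma symK : cancel sym read. Proof. by case. Qed.

(** Writing on a cell that the lists of a tape do not mention adds blanks to them.
    Tapes are therefore compared cell by cell, which is all that a machine sees. *)
Definition tape_eq t u : Prop :=
  (forall i, nth None (cells_left t) i = nth None (cells_left u) i) /\
  (forall i, nth None (cells_right t) i = nth None (cells_right u) i).

Lemma tape_eq_scan t u : tape_eq t u -> scan t = scan u.
Proof. by case=> _ /(_ 0); rewrite !nth0. Qed.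

Lemma tape_eq_update a m t u :
  tape_eq t u -> tape_eq (update a m t) (update a m u).
Proof.
case=> hl hr; have hb s s' : (forall i, nth None s i = nth None s' i) ->
  forall i, nth (None : symbol X) (behead s) i = nth None (behead s') i.
  by move=> h i; rewrite !nth_behead.
case: m => [[]|]; split=> [] /= [|i] //=; try exact: hb.
- by rewrite -!nth0.
- by case: i => [//|i] /=; apply: hb.
Qed.

Definition holds t x : Prop := tape_eq t (Tape [::] [seq sym o | o <- x]).

Lemma holds_scan t x : holds t x -> scan t = sym (head None x).
Proof. by move/tape_eq_scan->; case: x. Qed.

Definition prim_action (o : prim) (a : symbol X) : symbol X * move :=
  match o with
  | Grow => (a, Some false)
  | Put b => (Some (inl b), None)
  | Erase => (None, Some true)
  end.

Lemma holds_prim o t x : holds t x ->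
  holds (update (prim_action o (scan t)).1 (prim_action o (scan t)).2 t)
        (apply_prim o x).
Proof.
move=> h; have hs := holds_scan h; move: h => /tape_eq_update h.
case: o => [|b|] /=.
- have [h1 h2] := h (scan t) (Some false); split=> i.
    by rewrite h1.
  rewrite h2 /= {}hs; case: i => [//|[|i]] /=; first by case: (x).
  by case: (x) => [|y z]; rewrite //= !nth_nil.
- have [h1 h2] := h (Some (inl b)) None; split=> i; rewrite ?h1 ?h2 //=.
  by rewrite behead_map.
- have [h1 h2] := h None (Some true); split=> i; rewrite ?h1 ?h2 //=.
    by case: i => [|i] //=; rewrite nth_nil.
  by rewrite behead_map.
Qed.

Lemma holds_stay t x : holds t x -> holds (update (scan t) None t) x.
Proof.
move=> h; have hs := holds_scan h.
have [h1 h2] := tape_eq_update (scan t) None h; split=> i; rewrite ?h1 ?h2 //=.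
by case: i => [|i]; rewrite ?hs /=; case: (x) => //=; rewrite nth_nil.
Qed.
End Symbols.

Section Deterministic_prefix.
Variable M : machine.
Implicit Types c d : config M.

(** Runs along which each step is the only possible one. Every long enough run
    then passes through the end of the forced one ([forced_split]), whatever
    choices the machine has later. *)
Inductive forced : nat -> config M -> config M -> Prop :=
| ForcedNil c : forced 0 c c
| ForcedCons n c c1 d :
    (forall c2, step c c2 <-> c2 = c1) -> forced n c1 d -> forced n.+1 c d.

Lemma forced_run n c d : forced n c d -> run n c d.
Proof. by elim=> // {}n {}c c1 {}d hs _ IH; exists c1 => //; apply/hs. Qed.

Lemma halted_step c d : halted c -> ~ step c d.
Proof. by rewrite /halted /step => -> [a]; rewrite inE. Qed.

Lemma forced_split n c d m e :
  forced n c d -> run m c e -> (m < n /\ ~ halted e) \/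
    (n <= m /\ run (m - n) d e).
Proof.
move=> h; elim: h m => [c0 m hr|k c0 c1 d0 hs _ IH [|m] /=].
- by right; rewrite subn0.
- by move=> <-; left; split=> // /halted_step hh; apply: (hh c1); apply/hs.
- by case=> c2 /hs -> /IH [[lt hh]|[le hh]]; [left|right].
Qed.

Lemma run_trans n m c d e : run n c d -> run m d e -> run (n + m) c e.
Proof.
elim: n c => [c /= -> //|n IH c /= [c1 h1 h2] h3].
by exists c1 => //; apply: IH h3.
Qed.
End Deterministic_prefix.

Section Compose.
Variables (p : prog) (N : machine).

Definition reg_tape (i : register) : tape_index N + 'I_3 :=
  match i with
  | Main => inl (io N)
  | RegA => inr (Ordinal (isT : 0 < 3))
  | RegB => inr (Ordinal (isT : 1 < 3))
  | RegC => inr (Ordinal (isT : 2 < 3))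
  end.

Lemma reg_tape_inj : injective reg_tape.
Proof. by case; case. Qed.

Definition prog_action (e : option (register * prim))
    (f : {ffun tape_index N + 'I_3 -> symbol (aux N)}) :
    {ffun tape_index N + 'I_3 -> symbol (aux N) * move} :=
  [ffun i => if e is Some (j, o) then
               if i == reg_tape j then prim_action o (f i) else (f i, None)
             else (f i, None)].

Definition extend_action
    (a : {ffun tape_index N -> symbol (aux N) * move})
    (f : {ffun tape_index N + 'I_3 -> symbol (aux N)}) :
    {ffun tape_index N + 'I_3 -> symbol (aux N) * move} :=
  [ffun i => if i is inl j then a j else (f i, None)].

Definition prog_then_trans (q : pos p + state N)
    (f : {ffun tape_index N + 'I_3 -> symbol (aux N)}) :
    {set (pos p + state N) *
         {ffun tape_index N + 'I_3 -> symbol (aux N) * move}} :=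
  match q with
  | inl x =>
      let: (y, e) := next (fun i => read (f (reg_tape i))) x in
      [set (if y is Some z then inl z else inr (start N), prog_action e f)]
  | inr q =>
      [set (inr a.1, extend_action a.2 f) | a in trans q [ffun j => f (inl j)]]
  end.

(** The machine that runs [p] and then [N]. The main stack of [p] is the input
    tape of [N], so that the result of [p] is the input of [N]. The machine
    never halts during [p], and the nondeterminism of [N] is kept. *)
Definition prog_then : machine := {|
  state := (pos p + state N)%type;
  aux := aux N;
  tape_index := (tape_index N + 'I_3)%type;
  io := inl (io N);
  start := inl (entry p);
  accepting := fun q => if q is inr q' then accepting q' else false;
  trans := prog_then_trans
|}.

Lemma prog_then_deterministic : deterministic N -> deterministic prog_then.
Proof.
move=> dN [x|q] f /=; first by case: (next _ x) => y e; rewrite cards1.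
exact: leq_trans (leq_imset_card _ _) (dN _ _).
Qed.

Implicit Types (c : config prog_then) (d : config N) (s : store).

Definition represents c (x : option (pos p)) s : Prop :=
  [/\ cstate c = (if x is Some y then inl y else inr (start N)),
      forall i, holds (ctapes c (reg_tape i)) (stack s i) &
      forall j, (forall i, inl j <> reg_tape i) ->
                holds (ctapes c (inl j)) [::]].

Lemma step_uniq c a : actions c = [set a] ->
  forall c', step c c' <-> c' = Config a.1
    [ffun i => update (a.2 i).1 (a.2 i).2 (ctapes c i)].
Proof.
move=> ha c'; rewrite /step ha; split.
  by case=> b /set1P ->.
by move=> ->; exists a; rewrite ?set11.
Qed.

Lemma path_forced c x s n y s' :
  represents c x s -> path x s n y s' ->
  exists2 c', forced n c c' & represents c' y s'.
Proof.
move=> hc hp; elim: hp c hc => {x s n y s'} [x s c hc|x s n z s' _ IH c [hq ht hb]].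
  by exists c => //; apply: ForcedNil.
set y := next (top s) x.
pose c1 := @Config prog_then
  (if y.1 is Some z then inl z else inr (start N))
  [ffun i => update (prog_action y.2 (scanned c) i).1
               (prog_action y.2 (scanned c) i).2 (ctapes c i)].
have hs : forall c2, step c c2 <-> c2 = c1.
  have hn : next (fun i => read (scanned c (reg_tape i))) x = y.
    have E i : read (scanned c (reg_tape i)) = top s i.
      by rewrite ffunE (holds_scan (ht i)) symK.
    exact: eq_next.
  apply: (@step_uniq c (_, _)).
  by rewrite /actions hq /= hn; case: (y) => ? ?.
have [|c' hf hr] := IH c1; last by exists c' => //; apply: ForcedCons hf.
rewrite -/y; clear IH hs; split; first by rewrite /=; case: (y.1).
- move=> i; rewrite /c1 /= !ffunE; case: (y.2) => [[j o]|] /=; last exact: holds_stay.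
  case: eqP => [/reg_tape_inj <-|ne].
    rewrite (_ : stack _ i = apply_prim o (stack s i)); last by case: (s); case: (i).
    exact: holds_prim.
  rewrite (_ : stack _ i = stack s i); first exact: holds_stay.
  by case: (s) ne; case: i => ????; case: j => //= ne; case: ne.
- move=> j hj; rewrite /c1 /= !ffunE; case: (y.2) => [[k o]|] /=; last exact: holds_stay (hb _ hj).
  by case: eqP => [/hj //|_]; apply: holds_stay (hb _ hj).
Qed.

(** The second phase is a bisimulation up to trailing blanks, because the first
    phase leaves such blanks behind. *)
Definition simulates c d : Prop :=
  cstate c = inr (cstate d) /\
  forall i, tape_eq (ctapes c (inl i)) (ctapes d i).

Lemma simulates_actions c d : simulates c d ->
  actions c = [set (inr a.1, extend_action a.2 (scanned c)) | a in actions d].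
Proof.
case=> hq ht; rewrite /actions hq /=.
suff -> : [ffun j => scanned c (inl j)] = scanned d by [].
by apply/ffunP=> j; rewrite !ffunE; apply: tape_eq_scan.
Qed.

Lemma simulates_halted c d : simulates c d -> halted c <-> halted d.
Proof.
move=> /simulates_actions E; rewrite /halted E; split; last by move=> ->; rewrite imset0.
by move/eqP; rewrite imset_eq0 => /eqP.
Qed.

Lemma simulates_step c d : simulates c d ->
  (forall c', step c c' -> exists2 d', step d d' & simulates c' d') /\
  (forall d', step d d' -> exists2 c', step c c' & simulates c' d').
Proof.
move=> h; have E := simulates_actions h; case: h => hq ht.
have sim (a : state N * {ffun tape_index N -> symbol (aux N) * move})
  (b : {ffun tape_index N + 'I_3 -> symbol (aux N) * move}) :
  (forall i, b (inl i) = a.2 i) ->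
  simulates (@Config prog_then (inr a.1) [ffun i => update (b i).1 (b i).2 (ctapes c i)])
   (Config a.1 [ffun i => update (a.2 i).1 (a.2 i).2 (ctapes d i)]).
  by move=> hb; split=> // i; rewrite /= !ffunE hb; apply: tape_eq_update.
split=> [c' [a]|d' [a ha ->]].
  rewrite E => /imsetP [b hb -> ->] /=.
  eexists; first by exists b.
  by apply: sim => i; rewrite ffunE.
eexists; first by eexists; first (rewrite E; apply: imset_f ha).
by apply: sim => i; rewrite ffunE.
Qed.

Lemma simulates_run n c d : simulates c d ->
  (forall c', run n c c' -> exists2 d', run n d d' & simulates c' d') /\
  (forall d', run n d d' -> exists2 c', run n c c' & simulates c' d').
Proof.
elim: n c d => [|n IH] c d h.
  by split=> x /= <-; [exists d|exists c].
have [h1 h2] := simulates_step h; split=> x /=.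
  case=> c1 /h1 [d1 hd /IH [h3 _]] /h3 [d' hr hs].
  by exists d' => //; exists d1.
case=> d1 /h2 [c1 hd /IH [_ h3]] /h3 [c' hr hs].
by exists c' => //; exists c1.
Qed.

(** The run of [p] is forced, so all runs on [w] are this run followed by a run of
    [N] on [f w]. *)
Lemma prog_then_decides (f : word -> word) (T t : nat -> nat) (L : language) :
  (forall w, exists2 n, n <= T (size w) &
     exec p (Store [seq Some b | b <- w] [::] [::] [::]) n
            (Store [seq Some b | b <- f w] [::] [::] [::])) ->
  decides_in_time N t L ->
  forall T' : nat -> nat,
  (forall w, T (size w) + t (size (f w)) <= T' (size w)) ->
  decides_in_time prog_then T' (fun w => L (f w)).
Proof.
move=> hp hN T' hT w.
have [n hn /exec_path hpath] := hp w.
have hr : represents (init prog_then w) (Some (entry p))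
                    (Store [seq Some b | b <- w] [::] [::] [::]).
  split=> //.
    case; rewrite /= ffunE /=.
    1: by rewrite eqxx; split=> // i; rewrite /= -map_comp.
    1-3: by split.
  move=> j hj; rewrite /= ffunE; case: eqP => [[e]|ne]; last by split.
  by case: (hj Main); rewrite e.
have {hr hpath} [c hf [hq ht hb]] := path_forced hr hpath.
have hs : simulates c (init N (f w)).
  split=> //= i; rewrite ffunE; case: eqP => [->|ne].
    by have [h1 h2] := ht Main; split=> // j; rewrite h2 /= -map_comp.
  have [|h1 h2] := hb i; last by split.
  by move=> [] //= [] /ne.
have [hN1 hN2] := hN (f w).
have bound m c' : run m (init prog_then w) c' -> m <= T' (size w).
  move=> /(forced_split hf) [[lt _]|[le hr]].
    by apply: leq_trans (hT w); lia.
  have [/(_ _ hr) [d' /hN1 hd _] _] := simulates_run (m - n) hs.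
  by apply: leq_trans (hT w); lia.
split=> //; rewrite hN2; split.
  case=> m [d [hr hh ha]].
  have [_ /(_ _ hr) [c' hr' hs']] := simulates_run m hs.
  exists (n + m), c'; split.
  - exact: run_trans (forced_run hf) hr'.
  - exact/(simulates_halted hs').
  - by rewrite /=; case: hs' => ->.
case=> m [c' [/(forced_split hf) [[_ //]|[le hr]] hh ha]].
have [/(_ _ hr) [d hr' hs'] _] := simulates_run (m - n) hs.
exists (m - n), d; split=> //; first exact/(simulates_halted hs').
by move: ha; rewrite /=; case: hs' => ->.
Qed.
End Compose.

(** * Trees stored on a stack *)

Definition runs (p : prog) (s s' : store) (b : nat) : Prop :=
  exists2 n, n <= b & exec p s n s'.

Lemma runs_le p s s' b b' : b <= b' -> runs p s s' b -> runs p s s' b'.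
Proof. by move=> hb [n hn he]; exists n => //; apply: leq_trans hb. Qed.

Lemma runs_do i o s :
  runs (Do i o) s (set_stack i (apply_prim o (stack s i)) s) 1.
Proof. by exists 1 => //; apply: ExecDo. Qed.

Lemma runs_seq p q s s1 s2 b1 b2 :
  runs p s s1 b1 -> runs q s1 s2 b2 -> runs (Seq p q) s s2 (b1 + b2).
Proof.
by move=> [n hn h1] [m hm h2]; exists (n + m); [lia|exact: ExecSeq h1 h2].
Qed.

Lemma runs_if i (c : pred (option bool)) p q s s' b :
  runs (if c (top s i) then p else q) s s' b -> runs (If i c p q) s s' b.+1.
Proof. by move=> [n hn h]; exists n.+1 => //; apply: ExecIf. Qed.

Lemma runs_stop i (c : pred (option bool)) p s b :
  ~~ c (top s i) -> 0 < b -> runs (While i c p) s s b.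
Proof. by move=> hc hb; exists 1 => //; apply: ExecStop. Qed.

Lemma runs_loop i (c : pred (option bool)) p s s1 s2 b1 b2 :
  c (top s i) -> runs p s s1 b1 -> runs (While i c p) s1 s2 b2 ->
  runs (While i c p) s s2 (b1 + b2).+1.
Proof.
move=> hc [n hn h1] [m hm h2].
by exists (n + m).+1; [lia|exact: ExecLoop h1 h2].
Qed.

Definition push i b := Seq (Do i Grow) (Do i (Put b)).
Definition pop i := Do i Erase.
Definition is_true_bit (o : option bool) : bool := o == Some true.
Definition nonempty (o : option bool) : bool := o != None.

Lemma runs_push i b s : runs (push i b) s (set_stack i (Some b :: stack s i) s) 2.
Proof.
have := runs_seq (runs_do i Grow s) (runs_do i (Put b) _).
by case: s; case: i.
Qed.

(** A step adds at most one entry. Hence results of polynomial-time programs have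
    polynomial size without further hypotheses ([poly_size]). *)
Lemma exec_size p s n s' : exec p s n s' ->
  size (main s') + size (reg_a s') + size (reg_b s') + size (reg_c s') <=
  size (main s) + size (reg_a s) + size (reg_b s) + size (reg_c s) + n.
Proof.
elim=> {p s n s'} //=; try lia.
by case=> [] [|b|] [] m a b' c /=; rewrite ?size_behead; lia.
Qed.

Inductive tree := Leaf | Node of tree & tree.

(** Preorder is a prefix code: trees can lie on a stack above arbitrary other
    contents and still be told apart. *)
Fixpoint preorder (t : tree) : seq bool :=
  match t with
  | Leaf => [:: false]
  | Node a b => true :: preorder a ++ preorder b
  end.

Definition tokens (w : seq bool) : seq (option bool) := [seq Some b | b <- w].
Definition flat t := tokens (preorder t).

Definition on_main (m : seq (option bool)) : store := Store m [::] [::] [::].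

Lemma flat_node a b : flat (Node a b) = Some true :: flat a ++ flat b.
Proof. by rewrite /flat /tokens /= map_cat. Qed.

Lemma flat_leaf : flat Leaf = [:: Some false]. Proof. by []. Qed.

Lemma size_flat t : size (flat t) = size (preorder t).
Proof. exact: size_map. Qed.

(* Codes of constructors are unfolded by [flat_node] and [flat_leaf] only, so
   that simplification does not turn them into bits. *)
#[global] Opaque flat.

Section Pull.
Variables (emit : bool -> prog) (k : nat)
          (E : bool -> seq (option bool) * seq (option bool) ->
               seq (option bool) * seq (option bool)).
Hypothesis emitP : forall x m ab c,
  runs (emit x) (Store m ab.1 ab.2 c) (Store m (E x ab).1 (E x ab).2 c) k.

(** Reading one tree from the main stack. The last register holds one token for
    each subtree that is still to be read: a node replaces its token by two, a
    leaf removes its token, and the tree ends when no token is left. *)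
Definition pull_loop := While RegC nonempty (Seq (pop RegC)
  (If Main is_true_bit
     (Seq (pop Main) (Seq (emit true) (Seq (push RegC true) (push RegC true))))
     (Seq (pop Main) (emit false)))).

Definition pull := Seq (push RegC true) pull_loop.

(** The loop is followed to its end [s'], so that in the induction the second
    subtree can be the continuation of the first. *)
Lemma pull_loopP t r ab c s' b :
  let ab' := foldl (fun p x => E x p) ab (preorder t) in
  runs pull_loop (Store r ab'.1 ab'.2 c) s' b ->
  runs pull_loop (Store (flat t ++ r) ab.1 ab.2 (Some true :: c)) s'
    ((k + 8) * size (preorder t) + b).
Proof.
elim: t r ab c b => [|t1 IH1 t2 IH2] r ab c b /= h.
  rewrite flat_leaf; apply: runs_le; last apply: runs_loop h => //.
    2: apply: runs_seq; first exact: runs_do.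
    2: apply: runs_if => /=.
    2: apply: runs_seq; first exact: runs_do.
    2: exact: emitP.
  lia.
rewrite flat_node /=; apply: runs_le; last apply: runs_loop => //.
  2: apply: runs_seq; first exact: runs_do.
  2: apply: runs_if => /=.
  2: apply: runs_seq; first exact: runs_do.
  2: apply: runs_seq; first exact: emitP.
  2: apply: runs_seq; first exact: runs_push.
  2: exact: runs_push.
  2: rewrite /= -catA; apply: IH1; apply: IH2.
  2: rewrite foldl_cat in h; exact: h.
rewrite size_cat; lia.
Qed.

Lemma pullP t r ab :
  let ab' := foldl (fun p x => E x p) ab (preorder t) in
  runs pull (Store (flat t ++ r) ab.1 ab.2 [::]) (Store r ab'.1 ab'.2 [::])
    ((k + 8) * size (preorder t) + 3).
Proof.
move=> ab'; apply: runs_le; last first.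
  apply: runs_seq; first exact: runs_push.
  by apply: pull_loopP; apply: (@runs_stop _ _ _ _ 1).
lia.
Qed.
End Pull.

Definition pour i := While i nonempty (If i is_true_bit
   (Seq (pop i) (push Main true)) (Seq (pop i) (push Main false))).

Lemma pourP (i : register) w s : i <> Main -> stack s i = tokens w ->
  runs (pour i) s (set_stack Main (tokens (rev w) ++ main s) (set_stack i [::] s))
    (5 * size w + 1).
Proof.
move=> hi; elim: w s => [|x w IH] s hs.
  have -> : set_stack Main (tokens (rev [::]) ++ main s) (set_stack i [::] s) = s.
    by case: s hs hi; case: i => //= ???? ->.
  by apply: runs_stop => //; rewrite /top hs.
apply: runs_le; last first.
  apply: runs_loop; first by rewrite /top hs.
    pose s1 := set_stack Main (Some x :: main s) (set_stack i (tokens w) s).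
    apply: (@runs_if _ _ _ _ _ s1 3); rewrite {}/s1.
    have E : set_stack i (behead (stack s i)) s = set_stack i (tokens w) s by rewrite hs.
    rewrite /top hs /=; case: (x) => /=.
      apply: (@runs_seq _ _ _ _ _ 1 2); first exact: runs_do.
      rewrite /= E; have := runs_push Main true (set_stack i (tokens w) s).
      by case: (s); case: (i) hi.
    apply: (@runs_seq _ _ _ _ _ 1 2); first exact: runs_do.
    rewrite /= E; have := runs_push Main false (set_stack i (tokens w) s).
    by case: (s); case: (i) hi.
  have := IH (set_stack Main (Some x :: main s) (set_stack i (tokens w) s)).
  have -> : stack (set_stack Main (Some x :: main s) (set_stack i (tokens w) s)) i = tokens w.
    by case: (s); case: (i) hi.
  move=> /(_ erefl).
  rewrite rev_cons /tokens map_rcons cat_rcons.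
  have -> : main (set_stack Main (Some x :: main s)
     (set_stack i [seq Some b | b <- w] s)) = Some x :: main s.
    by case: (s); case: (i) hi.
  have -> : forall z, set_stack Main z
     (set_stack i [::] (set_stack Main (Some x :: main s)
       (set_stack i [seq Some b | b <- w] s))) = set_stack Main z (set_stack i [::] s).
    by case: (s); case: (i) hi.
  exact.
by rewrite /=; lia.
Qed.

Lemma foldl_push (w : seq bool) (a : seq (option bool)) :
  foldl (fun a x => Some x :: a) a w = tokens (rev w) ++ a.
Proof.
elim: w a => //= x w IH a.
by rewrite IH rev_cons /tokens map_rcons cat_rcons.
Qed.

Definition pull_a := pull (push RegA).
Definition pull_b := pull (push RegB).
Definition pull_ab := pull (fun x => Seq (push RegA x) (push RegB x)).

(** The bits are handled by erasing from an empty register, which does nothing. *)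
Definition discard := pull (fun _ => pop RegA).

Lemma pull_aP t r a b :
  runs pull_a (Store (flat t ++ r) a b [::])
    (Store r (tokens (rev (preorder t)) ++ a) b [::])
    (12 * size (preorder t) + 3).
Proof.
have := @pullP (push RegA) 2 (fun x ab => (Some x :: ab.1, ab.2)).
move=> /(_ (fun x m ab c => runs_push _ _ _)) /(_ t r (a, b)) /=.
rewrite -foldl_push.
have -> : forall (w : seq bool) a, foldl (fun (p : _ * seq (option bool)) x => (Some x :: p.1, p.2)) (a, b) w
  = (foldl (fun a x => Some x :: a) a w, b) by elim=> //=.
by apply: runs_le; lia.
Qed.

Lemma pull_bP t r a b :
  runs pull_b (Store (flat t ++ r) a b [::])
    (Store r a (tokens (rev (preorder t)) ++ b) [::])
    (12 * size (preorder t) + 3).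
Proof.
have := @pullP (push RegB) 2 (fun x ab => (ab.1, Some x :: ab.2)).
move=> /(_ (fun x m ab c => runs_push _ _ _)) /(_ t r (a, b)) /=.
rewrite -foldl_push.
have -> : forall (w : seq bool) b, foldl (fun (p : seq (option bool) * _) x => (p.1, Some x :: p.2)) (a, b) w
  = (a, foldl (fun a x => Some x :: a) b w) by elim=> //=.
by apply: runs_le; lia.
Qed.

Lemma pull_abP t r a b :
  runs pull_ab (Store (flat t ++ r) a b [::])
    (Store r (tokens (rev (preorder t)) ++ a) (tokens (rev (preorder t)) ++ b) [::])
    (12 * size (preorder t) + 3).
Proof.
have := @pullP (fun x => Seq (push RegA x) (push RegB x)) 4
   (fun x ab => (Some x :: ab.1, Some x :: ab.2)).
move=> /(_ (fun x m ab c => runs_seq (runs_push _ _ _) (runs_push _ _ _))) /(_ t r (a, b)) /=.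
rewrite -!foldl_push.
have -> : forall (w : seq bool) a b, foldl (fun (p : _ * _) x => (Some x :: p.1, Some x :: p.2)) (a, b) w
  = (foldl (fun a x => Some x :: a) a w, foldl (fun a x => Some x :: a) b w).
  by elim=> //=.
by apply: runs_le; lia.
Qed.

Lemma discardP t r :
  runs discard (on_main (flat t ++ r)) (on_main r) (12 * size (preorder t) + 3).
Proof.
have := @pullP (fun _ => pop RegA) 1 (fun x ab => (behead ab.1, ab.2)).
move=> /(_ (fun x m ab c => runs_do _ _ _)) /(_ t r ([::], [::])) /=.
have -> : forall w : seq bool, foldl (fun p (x : bool) => (behead p.1, p.2)) ([::], [::]) w
  = ([::], [::]) :> seq (option bool) * seq (option bool) by elim=> //=.
by apply: runs_le; lia.
Qed.

Definition duplicate := Seq pull_ab (Seq (pour RegA) (pour RegB)).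
Definition exchange := Seq pull_a (Seq pull_b (Seq (pour RegA) (pour RegB))).

Lemma duplicateP t r :
  runs duplicate (on_main (flat t ++ r)) (on_main (flat t ++ flat t ++ r))
    (22 * size (preorder t) + 5).
Proof.
apply: runs_le; last first.
  apply: runs_seq; first exact: pull_abP.
  rewrite !cats0.
  apply: runs_seq; first exact: (@pourP RegA (rev (preorder t))).
  rewrite /= revK.
  have := @pourP RegB (rev (preorder t)).
  by move=> /(_ (Store (flat t ++ r) [::] (tokens (rev (preorder t))) [::])) /= ;
     rewrite revK; apply.
by rewrite size_rev; lia.
Qed.

Lemma exchangeP t u r :
  runs exchange (on_main (flat t ++ flat u ++ r)) (on_main (flat u ++ flat t ++ r))
    (17 * (size (preorder t) + size (preorder u)) + 8).
Proof.
apply: runs_le; last first.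
  apply: runs_seq; first exact: pull_aP.
  apply: runs_seq; first exact: pull_bP.
  rewrite !cats0.
  apply: runs_seq; first exact: (@pourP RegA (rev (preorder t))).
  rewrite /= revK.
  have := @pourP RegB (rev (preorder u)).
  by move=> /(_ (Store (flat t ++ r) [::] (tokens (rev (preorder u))) [::])) /= ;
     rewrite revK; apply.
by rewrite !size_rev; lia.
Qed.

(** * Polynomial-time functions on coded types *)

(** Codes need not be injective: a type is given the code that a program reads or
    writes, for instance that of the encoding of an instance. *)
Structure codedType := Coded { carrier :> Type; code : carrier -> tree }.

Canonical coded_unit := @Coded unit (fun _ => Leaf).
#[warnings="-projection-no-head-constant"]
Canonical coded_bool :=
  @Coded bool (fun b => if b then Node Leaf Leaf else Leaf).
Canonical coded_prod (A B : codedType) :=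
  @Coded (A * B) (fun p => Node (code p.1) (code p.2)).

(** A nonempty list has the same code as the pair of its head and its tail, so
    that building and matching lists reduces to pairs. *)
Canonical coded_seq (A : codedType) :=
  @Coded (seq A) (foldr (fun x t => Node (code x) t) Leaf).

Definition sz (A : codedType) (a : A) : nat := size (preorder (code a)).
Definition enc (A : codedType) (a : A) := flat (code a).

Section Sizes.
Context {A B : codedType}.

Lemma sz_gt0 (a : A) : 0 < sz a.
Proof. by rewrite /sz; case: (code a). Qed.
Lemma sz_pair (a : A) (b : B) : sz (a, b) = (sz a + sz b).+1.
Proof. by rewrite /sz /= size_cat. Qed.
Lemma sz_nil : sz ([::] : seq A) = 1. Proof. by []. Qed.
Lemma sz_cons (a : A) s : sz (a :: s) = (sz a + sz s).+1.
Proof. by rewrite /sz /= size_cat. Qed.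
Lemma sz_bool (b : bool) : sz b <= 3. Proof. by case: b. Qed.
Lemma sz_cat (s t : seq A) : (sz (s ++ t)).+1 = sz s + sz t.
Proof. by elim: s => //= a s IH; rewrite !sz_cons; lia. Qed.
Lemma size_sz (s : seq A) : size s < sz s.
Proof. by elim: s => //= a s IH; rewrite sz_cons; have := sz_gt0 a; lia. Qed.
Lemma sz_rev (s : seq A) : sz (rev s) = sz s.
Proof.
elim: s => //= a s IH; rewrite rev_cons -cats1.
by have := sz_cat (rev s) [:: a]; rewrite !sz_cons sz_nil; lia.
Qed.
End Sizes.

Lemma sz_suffix (T : codedType) (s1 s2 : seq T) : sz s2 <= sz (s1 ++ s2).
Proof. by have := sz_cat s1 s2; have := sz_gt0 s1; lia. Qed.

Lemma sz_prefix (T : codedType) (s1 s2 : seq T) : sz s1 <= sz (s1 ++ s2).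
Proof. by have := sz_cat s1 s2; have := sz_gt0 s2; lia. Qed.

Lemma sz_seq (T : codedType) (s : seq T) k :
  (forall x : T, sz x <= k) -> sz s <= size s * k.+1 + 1.
Proof.
by move=> h; elim: s => //= x s IH; rewrite sz_cons; have := h x; lia.
Qed.

Lemma sz_word (w : word) : sz w <= size w * 4 + 1.
Proof. exact/sz_seq/sz_bool. Qed.

(** Up to a change of the exponent, powers of [n + 2] are closed under constants,
    sums, products and composition. *)
Definition pbound c n := (n + 2) ^ c.

Lemma pbound_mono c m n : m <= n -> pbound c m <= pbound c n.
Proof. by case: c => [|c] h //; rewrite /pbound leq_exp2r ?leq_add2r. Qed.

Lemma pbound_exp c d n : c <= d -> pbound c n <= pbound d n.
Proof. by move=> h; rewrite /pbound leq_exp2l // addn2. Qed.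

Lemma pbound_const k n : k <= pbound k n.
Proof.
apply: leq_trans (ltnW (ltn_expl k (isT : 1 < 2))) _.
by case: k => [|k] //; rewrite leq_exp2r ?leq_addl.
Qed.

Lemma pbound_add c d n : pbound c n + pbound d n <= pbound (c + d).+1 n.
Proof.
have h1 := pbound_exp n (leq_addr d c); have h2 := pbound_exp n (leq_addl c d).
rewrite /pbound expnS in h1 h2 *.
by apply: leq_trans (leq_add h1 h2) _; rewrite addnn -mul2n leq_mul2r leq_addl orbT.
Qed.

Lemma pbound_mul c d n : pbound c n * pbound d n = pbound (c + d) n.
Proof. by rewrite /pbound expnD. Qed.

Lemma pbound_comp c d n : pbound c (pbound d n) <= pbound (d.+2 * c) n.
Proof.
rewrite /pbound expnM.
case: c => [|c] //; rewrite leq_exp2r // !expnS.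
have : 0 < (n + 2) ^ d by rewrite expn_gt0 addn2.
move: (_ ^ d) => x; nia.
Qed.

Definition bounded (A : codedType) (T : A -> nat) : Prop :=
  exists c, forall a, T a <= pbound c (sz a).

Section Bounded.
Context {A : codedType}.
Implicit Types T U : A -> nat.

Lemma bounded_le T U : (forall a, T a <= U a) -> bounded U -> bounded T.
Proof. by move=> h [c hc]; exists c => a; apply: leq_trans (hc a). Qed.

Lemma bounded_const k : bounded (fun _ : A => k).
Proof. by exists k => a; apply: pbound_const. Qed.

Lemma bounded_sz : bounded (fun a : A => sz a).
Proof. by exists 1 => a; rewrite /pbound expn1 leq_addr. Qed.

Lemma bounded_add T U : bounded T -> bounded U -> bounded (fun a => T a + U a).
Proof.
move=> [c hc] [d hd]; exists (c + d).+1 => a.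
exact: leq_trans (leq_add (hc a) (hd a)) (pbound_add _ _ _).
Qed.

Lemma bounded_mul T U : bounded T -> bounded U -> bounded (fun a => T a * U a).
Proof.
move=> [c hc] [d hd]; exists (c + d) => a.
by rewrite -pbound_mul leq_mul.
Qed.

Lemma bounded_pbound c T : bounded T -> bounded (fun a => pbound c (T a)).
Proof.
move=> [d hd]; exists (d.+2 * c) => a.
exact: leq_trans (pbound_mono _ (hd a)) (pbound_comp _ _ _).
Qed.

Lemma bounded_comp (B : codedType) (f : A -> B) (T : B -> nat) :
  bounded (fun a => sz (f a)) -> bounded T -> bounded (fun a => T (f a)).
Proof.
move=> hf [c hc]; apply: bounded_le (fun a => hc (f a)) _.
exact: bounded_pbound.
Qed.
End Bounded.

(** Programs leave the stack [r] below their argument intact, which lets other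
    values wait there: this is what makes programs composable without any
    allocation of registers. *)
Definition computes (A B : codedType) (p : prog) (f : A -> B)
    (T : A -> nat) : Prop :=
  forall a r, runs p (on_main (enc a ++ r)) (on_main (enc (f a) ++ r)) (T a).

Definition poly (A B : codedType) (f : A -> B) : Prop :=
  exists p T, bounded T /\ computes p f T.

Lemma computes_size (A B : codedType) p (f : A -> B) T a :
  computes p f T -> sz (f a) <= sz a + T a.
Proof.
move=> /(_ a [::]) [n hn /exec_size /=]; rewrite !cats0 !addn0.
by rewrite /enc /sz !size_flat; lia.
Qed.

Lemma poly_size (A B : codedType) (f : A -> B) :
  poly f -> bounded (fun a => sz (f a)).
Proof.
move=> [p [T [hT hp]]]; apply: bounded_le (fun a => computes_size a hp) _.
by apply: bounded_add => //; apply: bounded_sz.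
Qed.

(** Polynomial-time computability is a property of codes; this lemma transfers it
    between types that share them. *)
Lemma poly_recode (A B A' B' : codedType) (i : A' -> A) (f : A -> B) (g : A' -> B') :
  (forall a, code (i a) = code a) -> (forall a, code (g a) = code (f (i a))) ->
  poly f -> poly g.
Proof.
move=> hi hg [p [T [[c hT] hp]]]; exists p, (T \o i); split.
  by exists c => a; apply: leq_trans (hT (i a)) _; rewrite /sz hi.
by move=> a r; rewrite /enc hg -hi; apply: hp.
Qed.

Lemma poly_ext (A B : codedType) (f g : A -> B) :
  f =1 g -> poly f -> poly g.
Proof. by move=> h; apply: (@poly_recode A B A B id) => // a; rewrite h. Qed.

Section Combinators.
Context {A B C : codedType}.

Lemma computes_comp p q (f : A -> B) (g : B -> C) T U :
  computes p f T -> computes q g U ->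
  computes (Seq p q) (fun a => g (f a)) (fun a => T a + U (f a)).
Proof. by move=> hp hq a r; apply: runs_seq (hp a r) (hq (f a) r). Qed.

Lemma poly_comp (f : A -> B) (g : B -> C) :
  poly g -> poly f -> poly (fun a => g (f a)).
Proof.
move=> [q [U [hU hq]]] hf; have hs := poly_size hf.
case: hf => [p [T [hT hp]]].
exists (Seq p q), (fun a => T a + U (f a)); split; last exact: computes_comp.
by apply: bounded_add => //; apply: bounded_comp.
Qed.

Lemma poly_id : poly (fun a : A => a).
Proof.
exists (Do RegA Erase), (fun => 1); split; first exact: bounded_const.
by move=> a r; apply: (runs_do RegA Erase (on_main _)).
Qed.

Lemma poly_pair (f : A -> B) (g : A -> C) :
  poly f -> poly g -> poly (fun a => (f a, g a)).
Proof.
move=> hf hg; have hs := poly_size hg.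
case: hf => [p [T [hT hp]]]; case: hg => [q [U [hU hq]]].
(* The second component is computed first, so that the first one ends on top of
   it, as in the code of the pair. *)
exists (Seq duplicate (Seq q (Seq exchange (Seq p (push Main true))))),
  (fun a => (22 * sz a + 5) + (U a + ((17 * (sz (g a) + sz a) + 8) + (T a + 2)))).
split.
  by do ![apply: bounded_add|apply: bounded_mul|apply: bounded_const|
          apply: bounded_sz|done].
move=> a r; apply: runs_seq; first exact: duplicateP.
apply: runs_seq; first exact: hq.
apply: runs_seq; first exact: exchangeP.
apply: runs_seq; first exact: hp.
by rewrite /enc flat_node /= -catA; apply: (runs_push Main true (on_main _)).
Qed.

Lemma poly_fst : poly (fun p : B * C => p.1).
Proof.
exists (Seq (pop Main) (Seq exchange discard)),
  (fun p => 1 + ((17 * (sz p.1 + sz p.2) + 8) + (12 * sz p.2 + 3))).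
split.
  apply: (bounded_le (U := fun p : B * C => 30 * sz p + 12)); last first.
    by do ![apply: bounded_add|apply: bounded_mul|apply: bounded_const|
          apply: bounded_sz|done].
  by move=> [b c]; rewrite sz_pair /=; lia.
move=> [b c] r; rewrite /enc flat_node /= -catA.
apply: runs_seq; first exact: (runs_do Main Erase (on_main _)).
apply: runs_seq; first exact: exchangeP.
exact: discardP.
Qed.

Lemma poly_snd : poly (fun p : B * C => p.2).
Proof.
exists (Seq (pop Main) discard), (fun p => 1 + (12 * sz p.1 + 3)).
split.
  apply: (bounded_le (U := fun p : B * C => 30 * sz p + 12)); last first.
    by do ![apply: bounded_add|apply: bounded_mul|apply: bounded_const|
          apply: bounded_sz|done].
  by move=> [b c]; rewrite sz_pair /=; lia.
move=> [b c] r; rewrite /enc flat_node /= -catA.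
apply: runs_seq; first exact: (runs_do Main Erase (on_main _)).
exact: discardP.
Qed.

Fixpoint write (w : seq bool) : prog :=
  if w is x :: w' then Seq (write w') (push Main x) else Do RegB Erase.

Lemma writeP w m a c :
  runs (write w) (Store m a [::] c) (Store (tokens w ++ m) a [::] c)
    (2 * size w + 1).
Proof.
elim: w => [|x w IH] /=; first exact: (runs_do RegB Erase (Store _ _ _ _)).
apply: runs_le; last first.
  by apply: runs_seq IH _; apply: (runs_push Main x (Store _ _ _ _)).
by rewrite /=; lia.
Qed.

Lemma poly_const (b : B) : poly (fun _ : A => b).
Proof.
exists (Seq discard (write (preorder (code b)))),
  (fun a => (12 * sz a + 3) + (2 * sz b + 1)); split.
  by do ![apply: bounded_add|apply: bounded_mul|apply: bounded_const|
          apply: bounded_sz|done].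
move=> a r; apply: runs_seq; first exact: discardP.
exact: writeP.
Qed.

(** The list is computed on a copy of the argument and inspected at its first
    symbol. If it is not empty, one more symbol combines the argument and the
    list into the code of the triple on which [g] runs. *)
Lemma poly_match (l : A -> seq B) (f : A -> C) (g : A * (B * seq B) -> C) :
  poly l -> poly f -> poly g ->
  poly (fun a => if l a is x :: s then g (a, (x, s)) else f a).
Proof.
move=> hl [p [T [hT hp]]] [q [U [hU hq]]]; have hs := poly_size hl.
case: hl => [o [V [hV ho]]].
pose U' a := if l a is x :: s then U (a, (x, s)) else 0.
exists (Seq duplicate (Seq o (If Main is_true_bit
     (Seq exchange (Seq (push Main true) q)) (Seq (pop Main) p)))),
  (fun a => (22 * sz a + 5) + (V a + ((17 * (sz (l a) + sz a) + 8) +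
     (2 + U' a) + (1 + T a)).+1)); split.
  have hU' : bounded U'.
    have [c hc] := hU; apply: (bounded_le (U := fun a => pbound c (sz a + sz (l a) + 1))).
      move=> a; rewrite /U'; case: (l a) => [//|x s].
      apply: leq_trans (hc _) _; apply: pbound_mono; rewrite !sz_pair sz_cons; lia.
    apply: bounded_pbound.
    by do ![apply: bounded_add|apply: bounded_mul|apply: bounded_const|
          apply: bounded_sz|done].
  apply: (bounded_le (U := fun a => (22 * sz a + 5) + (V a + ((17 * (sz (l a) + sz a) + 8) +
     (2 + U' a) + (1 + T a) + 1)))); first by move=> a; lia.
  by do ![apply: bounded_add|apply: bounded_mul|apply: bounded_const|
          apply: bounded_sz|done].
move=> a r; apply: runs_seq; first exact: duplicateP.
apply: runs_seq; first exact: ho.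
apply: runs_if; rewrite /U' /enc; case: (l a) => [|x s] /=.
  rewrite flat_leaf /=; apply: (@runs_le _ _ _ (1 + T a)); first by lia.
  by apply: runs_seq; [exact: (runs_do Main Erase (on_main _))|exact: hp].
change (code (x :: s)) with (code (x, s)).
rewrite {1}flat_node /=.
apply: (@runs_le _ _ _ ((17 * (sz (x, s) + sz a) + 8) + (2 + U (a, (x, s))))).
  by rewrite sz_pair sz_cons; lia.
apply: runs_seq; first exact: (@exchangeP (code (x, s))).
apply: runs_seq; first exact: (runs_push Main true (on_main _)).
by have := hq (a, (x, s)) r; rewrite /enc flat_node /= -catA.
Qed.
End Combinators.

(** * Iteration over a list *)

Ltac bounds := do ![done|apply: bounded_add|apply: bounded_mul|apply: bounded_const
  |apply: bounded_sz|apply: bounded_pbound].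

Section Derived.
Context {A B C : codedType}.

Lemma poly_fst_of (f : A -> B * C) : poly f -> poly (fun a => (f a).1).
Proof. by move=> h; apply: (poly_comp poly_fst h). Qed.

Lemma poly_snd_of (f : A -> B * C) : poly f -> poly (fun a => (f a).2).
Proof. by move=> h; apply: (poly_comp poly_snd h). Qed.

Lemma poly_cons (f : A -> B) (g : A -> seq B) :
  poly f -> poly g -> poly (fun a => f a :: g a).
Proof. by move=> hf hg; apply: (poly_recode _ _ (poly_pair hf hg)). Qed.

Lemma poly_if (c : A -> bool) (f g : A -> C) :
  poly c -> poly f -> poly g -> poly (fun a => if c a then f a else g a).
Proof.
move=> hc hf hg.
have hl : poly (fun a => if c a then [:: tt] else [::]).
  by apply: (poly_recode (i := id) _ _ hc) => // a; case: (c a).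
apply: (poly_ext _ (poly_match (g := fun p => f p.1) hl hg (poly_comp hf poly_fst))).
by move=> a; case: (c a).
Qed.
End Derived.

Section Loops.
Context {S T : codedType}.

(** The list and the state lie on the stack as the two components of a pair whose
    constructor is removed; it is put back around each call of the body, so that
    the body is an ordinary function on pairs. *)
Definition list_loop (p : prog) :=
  Seq (pop Main) (Seq (While Main is_true_bit
    (Seq (push Main true) (Seq p (pop Main)))) (pop Main)).

Lemma runs_foldl p (h : S -> T -> S) U :
  computes p (fun q : (T * seq T) * S => (q.1.2, h q.2 q.1.1)) U ->
  forall l s b r,
  (forall s1 x s2, l = s1 ++ x :: s2 -> U ((x, s2), foldl h s s1) <= b) ->
  runs (list_loop p) (on_main (enc (l, s) ++ r))
    (on_main (enc (foldl h s l) ++ r)) (size l * (b + 4) + 3).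
Proof.
move=> hp l s b r hb.
rewrite {1}/enc flat_node /= -catA.
apply: (@runs_le _ _ _ (1 + ((size l * (b + 4) + 1) + 1))); first by lia.
apply: runs_seq; first exact: (runs_do Main Erase (on_main _)).
apply: (@runs_seq _ _ _ (on_main (flat Leaf ++ enc (foldl h s l) ++ r))); last first.
  by rewrite flat_leaf; apply: (runs_do Main Erase (on_main _)).
rewrite /= -!/(enc _).
elim: l s hb => [|x l IH] s hb.
  by rewrite /enc; apply: runs_stop; rewrite ?flat_leaf.
apply: (@runs_le _ _ _ ((2 + (b + 1)) + (size l * (b + 4) + 1)).+1).
  by rewrite /=; lia.
apply: runs_loop; first by rewrite {1}/enc flat_node.
  apply: runs_seq; first exact: (runs_push Main true (on_main _)).
  apply: runs_seq; last first.
    exact: (runs_do Main Erase (on_main (Some true :: enc l ++ enc (h s x) ++ r))).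
  have := hp ((x, l), s) r; rewrite /enc ![flat (Node _ _)]flat_node /= -!catA.
  by apply: runs_le; exact: (hb [::] x l erefl).
by apply: IH => s1 y s2 e; apply: (hb (x :: s1)); rewrite e.
Qed.
End Loops.

(** A polynomial-time step may be iterated along a list if all intermediate states
    have polynomial size. In the proof the state carries the parameter [a]
    along, since the step depends on it. *)
Lemma poly_foldl (A S T : codedType)
    (l : A -> seq T) (i : A -> S) (h : A -> S -> T -> S) (B : A -> nat) :
  poly l -> poly i -> poly (fun q : A * S * T => h q.1.1 q.1.2 q.2) ->
  bounded B ->
  (forall a s1 s2, l a = s1 ++ s2 -> sz (foldl (h a) (i a) s1) <= B a) ->
  poly (fun a => foldl (h a) (i a) (l a)).
Proof.
move=> hl hi hh hB hc; have bl := poly_size hl.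
pose h' (s : A * S) x := (s.1, h s.1 s.2 x).
have E a s m : foldl h' (a, s) m = (a, foldl (h a) s m).
  by elim: m s => //= x m IH s; rewrite IH.
suff H : poly (fun a => foldl h' (a, i a) (l a)).
  by apply: poly_ext (poly_snd_of H) => a; rewrite E.
(* The pair of a nonempty list and a state has the code of the argument of the
   body, which returns the tail and the new state. *)
have [p [U [[d hd] hp]]] :
    poly (fun q : (T * seq T) * (A * S) => (q.1.2, h' q.2 q.1.1)).
  apply: poly_pair; first exact: poly_snd_of (poly_fst).
  apply: poly_pair; first exact: poly_fst_of poly_snd.
  apply: (poly_comp (f := fun q : T * seq T * (A * S) => ((q.2.1, q.2.2), q.1.1)) hh).
  apply: poly_pair; last exact: poly_fst_of poly_fst.
  apply: poly_pair; first exact: poly_fst_of poly_snd.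
  exact: poly_snd_of poly_snd.
have [q [V [hV hq]]] := poly_pair hl (poly_pair poly_id hi).
pose b a := pbound d (sz (l a) + sz a + B a + 3).
exists (Seq q (list_loop p)), (fun a => V a + (sz (l a) * (b a + 4) + 3)).
split; first by rewrite /b; bounds.
move=> a r; apply: runs_seq; first exact: hq.
apply: (@runs_le _ _ _ (size (l a) * (b a + 4) + 3)).
  by have := size_sz (l a); nia.
apply: (runs_foldl hp) => s1 x s2 e; apply: leq_trans (hd _) _.
apply: pbound_mono; rewrite E !sz_pair.
by have := hc a s1 _ e; have := sz_suffix s1 (x :: s2); rewrite -e sz_cons; lia.
Qed.

(** * Lists *)

(* The goals are matched syntactically because unification would otherwise unfold
   the functions in search of a pair or a conditional. *)
Ltac poly_step := lazymatch goal with
  | |- poly (fun a => a) => exact: poly_id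
  | |- poly id => exact: poly_id
  | |- poly fst => exact: poly_fst
  | |- poly snd => exact: poly_snd
  | |- poly (fun _ => ?c) => exact: poly_const
  | |- poly (fun a => (_, _)) => apply: poly_pair
  | |- poly (fun a => _ :: _) => apply: poly_cons
  | |- poly (fun a => if _ then _ else _) => apply: poly_if
  | |- poly (fun p => p.1) => exact: poly_fst
  | |- poly (fun p => p.2) => exact: poly_snd
  | |- poly (fun a => (@?f a).1) => apply: (@poly_fst_of _ _ _ f)
  | |- poly (fun a => (@?f a).2) => apply: (@poly_snd_of _ _ _ f)
  | |- _ => assumption
  end.
Ltac poly := repeat poly_step.

Section Basic.
Context {A B S T : codedType}.

Lemma poly_negb (c : A -> bool) : poly c -> poly (fun a => ~~ c a).
Proof.
by move=> h; apply: (poly_ext (f := fun a => if c a then false else true)); poly.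
Qed.

Lemma poly_andb (c d : A -> bool) : poly c -> poly d -> poly (fun a => c a && d a).
Proof.
by move=> h h'; apply: (poly_ext (f := fun a => if c a then d a else false)); poly.
Qed.

Lemma poly_orb (c d : A -> bool) : poly c -> poly d -> poly (fun a => c a || d a).
Proof.
by move=> h h'; apply: (poly_ext (f := fun a => if c a then true else d a)); poly.
Qed.

Lemma poly_behead (l : A -> seq T) : poly l -> poly (fun a => behead (l a)).
Proof.
move=> h; apply: (poly_ext _ (poly_match (f := fun=> [::]) (g := fun q => q.2.2) h _ _)); poly.
by move=> a; case: (l a).
Qed.

Lemma poly_head (l : A -> seq T) d : poly l -> poly (fun a => head d (l a)).
Proof.
move=> h; apply: (poly_ext _ (poly_match (f := fun=> d) (g := fun q => q.2.1) h _ _)); poly.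
by move=> a; case: (l a).
Qed.

Lemma poly_nilp (l : A -> seq T) : poly l -> poly (fun a => nilp (l a)).
Proof.
move=> h; apply: (poly_ext _ (poly_match (f := fun=> true) (g := fun q => false) h _ _)); poly.
by move=> a; case: (l a).
Qed.

Lemma poly_nth (l : A -> seq T) d k : poly l -> poly (fun a => nth d (l a) k).
Proof.
move=> h; elim: k l h => [|k IH] l h.
  by apply: (poly_ext _ (poly_head d h)) => a; case: (l a).
apply: (poly_ext _ (IH _ (poly_behead h))) => a.
by rewrite nth_behead.
Qed.

Lemma foldl_cons (s t : seq T) : foldl (fun acc x => x :: acc) t s = rev s ++ t.
Proof. by elim: s t => //= x s IH t; rewrite IH rev_cons cat_rcons. Qed.

Lemma poly_catrev (f g : A -> seq T) : poly f -> poly g ->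
  poly (fun a => rev (f a) ++ g a).
Proof.
move=> hf hg; apply: (poly_ext (fun a => foldl_cons (f a) (g a))).
apply: (poly_foldl (B := fun a => sz (f a) + sz (g a))) => //; poly.
  by bounds; apply: poly_size.
move=> a s1 s2 e; rewrite foldl_cons e.
have := sz_cat (rev s1) (g a); have := sz_cat s1 s2; rewrite sz_rev.
by have := sz_gt0 s2; lia.
Qed.

Lemma poly_rev (f : A -> seq T) : poly f -> poly (fun a => rev (f a)).
Proof.
by move=> h; apply: (poly_ext _ (poly_catrev h (poly_const [::]))) => a; rewrite cats0.
Qed.

Lemma poly_cat (f g : A -> seq T) : poly f -> poly g -> poly (fun a => f a ++ g a).
Proof.
move=> hf hg; apply: (poly_ext _ (poly_catrev (poly_rev hf) hg)) => a.
by rewrite revK.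
Qed.

End Basic.

Section Lists.
Context {A S T : codedType}.

Lemma poly_map (h : A -> S -> T) (l : A -> seq S) :
  poly (fun q : A * S => h q.1 q.2) -> poly l ->
  poly (fun a => [seq h a x | x <- l a]).
Proof.
move=> hh hl; have E a s t : foldl (fun acc x => h a x :: acc) t s =
    rev [seq h a x | x <- s] ++ t.
  by elim: s t => //= x s IH t; rewrite IH rev_cons cat_rcons.
suff H : poly (fun a => foldl (fun acc x => h a x :: acc) [::] (l a)).
  by apply: (poly_ext _ (poly_rev H)) => a; rewrite E cats0 revK.
have [c hc] := poly_size hh; have hs := poly_size hl.
pose b a := pbound c (sz a + sz (l a) + 1) + 1.
apply: (poly_foldl (B := fun a => sz (l a) * b a + 1)) => //; poly.
- by apply: (poly_comp (f := fun q : A * seq T * S => (q.1.1, q.2)) hh); poly.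
- by rewrite /b; bounds.
move=> a s1 s2 e; rewrite E cats0 sz_rev.
suff H m : sz m <= sz (l a) -> sz [seq h a x | x <- m] <= size m * b a + 1.
  apply: leq_trans (H s1 _) _; first by rewrite e sz_prefix.
  rewrite leq_add2r leq_mul2r; apply/orP; right.
  by have := size_sz (l a); rewrite e size_cat; lia.
elim: m => // x m IH; rewrite sz_cons => hm.
rewrite map_cons [sz (_ :: _)]sz_cons [size _]/=.
have h1 : sz (h a x) + 1 <= b a.
  rewrite /b leq_add2r; apply: leq_trans (hc (a, x)) _; apply: pbound_mono.
  by rewrite sz_pair; lia.
have {}IH : sz [seq h a x | x <- m] <= size m * b a + 1 by apply: IH; lia.
by rewrite mulSn; lia.
Qed.

Lemma poly_foldl_bool (h : A -> bool -> S -> bool) (l : A -> seq S) b0 :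
  poly (fun q : A * bool * S => h q.1.1 q.1.2 q.2) -> poly l ->
  poly (fun a => foldl (h a) b0 (l a)).
Proof.
move=> hh hl; apply: (poly_foldl (B := fun=> 3)) => //; poly; first by bounds.
by move=> *; apply: sz_bool.
Qed.

Lemma poly_has (h : A -> S -> bool) (l : A -> seq S) :
  poly (fun q : A * S => h q.1 q.2) -> poly l ->
  poly (fun a => has (h a) (l a)).
Proof.
move=> hh hl.
apply: (poly_ext (f := fun a => foldl (fun b x => b || h a x) false (l a))).
  move=> a; rewrite -[RHS]orFb; elim: (l a) false => [|x s IH] b /=; first by rewrite orbF.
  by rewrite IH orbA.
apply: poly_foldl_bool => //; apply: poly_orb; poly.
by apply: (poly_comp (f := fun q : A * bool * S => (q.1.1, q.2)) hh); poly.
Qed.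

Lemma poly_all (h : A -> S -> bool) (l : A -> seq S) :
  poly (fun q : A * S => h q.1 q.2) -> poly l ->
  poly (fun a => all (h a) (l a)).
Proof.
move=> hh hl; apply: (poly_ext (f := fun a => ~~ has (fun x => ~~ h a x) (l a))).
  by move=> a; rewrite -all_predC; apply: eq_all => x /=; rewrite negbK.
by apply: poly_negb; apply: poly_has => //; apply: poly_negb.
Qed.

Lemma sz_flatten_prefix (s1 s2 : seq (seq T)) :
  sz (flatten s1) <= sz (s1 ++ s2).
Proof.
apply: leq_trans (sz_prefix s1 s2); elim: s1 => //= x s IH.
by have := sz_cat x (flatten s); rewrite sz_cons; lia.
Qed.

Lemma poly_flatten (l : A -> seq (seq T)) : poly l -> poly (fun a => flatten (l a)).
Proof.
move=> hl; have E s t : foldl cat t s = t ++ flatten s :> seq T.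
  by elim: s t => /= [|x s IH] t; rewrite ?cats0 // IH catA.
apply: (poly_ext (f := fun a => foldl cat [::] (l a))) => [a|]; first exact: E.
apply: (poly_foldl (B := fun a => sz (l a))) => //; poly; last first.
- by move=> a s1 s2 e; rewrite E e sz_flatten_prefix.
- exact: poly_size.
- by apply: poly_cat; poly.
Qed.

Definition split_at U (l : seq U) (s : seq T) : seq T * seq T :=
  (take (size l) s, drop (size l) s).

Lemma poly_split_at (l : A -> seq S) (s : A -> seq T) : poly l -> poly s ->
  poly (fun a => split_at (l a) (s a)).
Proof.
move=> hl hs.
pose h (p : seq T * seq T) (x : S) :=
  if p.2 is y :: r then (y :: p.1, r) else p.
have E m t r : foldl h (r, t) m = (rev (take (size m) t) ++ r, drop (size m) t).
  elim: m t r => [|x m IH] [|y t] r //=; first by rewrite IH.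
  by rewrite /h /= IH rev_cons cat_rcons.
suff H : poly (fun a => foldl h ([::], s a) (l a)).
  have H' : poly (fun a => (rev (foldl h ([::], s a) (l a)).1,
                           (foldl h ([::], s a) (l a)).2)).
    by apply: poly_pair; [apply: poly_rev|]; poly.
  by apply: (poly_ext _ H') => a; rewrite E /= cats0 revK.
apply: (poly_foldl (B := fun a => 2 * sz (s a) + 1)) => //; poly.
- have H : poly (fun q : A * (seq T * seq T) * S => q.1.2) by poly.
  apply: (poly_ext _ (poly_match (l := fun q => q.1.2.2) (f := fun q => q.1.2)
    (g := fun q => (q.2.1 :: q.1.1.2.1, q.2.2)) _ _ _)); poly.
  by move=> [[a [u [|y r]]] x].
- by bounds; apply: poly_size.
- move=> a s1 s2 e; rewrite E cats0 sz_pair sz_rev.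
  by have := sz_cat (take (size s1) (s a)) (drop (size s1) (s a)); have := sz_gt0 (s a);
     rewrite cat_take_drop; lia.
Qed.

Lemma poly_mask (m : A -> seq bool) (s : A -> seq T) : poly m -> poly s ->
  poly (fun a => mask (m a) (s a)).
Proof.
move=> hm hs.
pose h (p : seq T * seq T) (b : bool) :=
  if p.2 is y :: r then ((if b then y :: p.1 else p.1), r) else p.
have E m' t r : foldl h (r, t) m' = (rev (mask m' t) ++ r, drop (size m') t).
  elim: m' t r => [|x m' IH] [|y t] r //=; first by rewrite IH mask0.
  by rewrite /h /= IH; case: x => //=; rewrite rev_cons cat_rcons.
suff H : poly (fun a => foldl h ([::], s a) (m a)).
  by apply: (poly_ext _ (poly_rev (poly_fst_of H))) => a; rewrite E /= cats0 revK.
apply: (poly_foldl (B := fun a => 2 * sz (s a) + 1)) => //; poly.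
- apply: (poly_ext _ (poly_match (l := fun q => q.1.2.2) (f := fun q => q.1.2)
    (g := fun q => ((if q.1.2 then q.2.1 :: q.1.1.2.1 else q.1.1.2.1), q.2.2)) _ _ _)); poly.
  by move=> [[a [u [|y r]]] x].
- by bounds; apply: poly_size.
- move=> a s1 s2 e; rewrite E cats0 sz_pair sz_rev.
  have H : sz (mask s1 (s a)) <= sz (s a).
    elim: (s1) (s a) => [|b z IH] t; first by rewrite mask0s sz_nil sz_gt0.
    case: t => [|y t]; first by rewrite mask0.
    rewrite mask_cons; have := IH t.
    by case: b; rewrite [sz (y :: t)]sz_cons ?cat1s ?sz_cons ?cat0s; lia.
  rewrite -addSn; apply: leq_trans (leq_add (H : _ < _.+1) (sz_suffix (take (size s1) (s a)) _)) _.
  by rewrite cat_take_drop; lia.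
Qed.
End Lists.

Lemma poly_size_leq (A S T : codedType) (l : A -> seq S) (s : A -> seq T) : poly l -> poly s ->
  poly (fun a => size (l a) <= size (s a)).
Proof.
move=> hl hs; have H := poly_nilp (poly_snd_of (poly_split_at hs hl)).
by apply: (poly_ext _ H) => a; rewrite /nilp size_drop.
Qed.

Section Sizes.
Context {A S T : codedType}.

Lemma poly_size_eq (l : A -> seq S) (s : A -> seq T) : poly l -> poly s ->
  poly (fun a => size (l a) == size (s a)).
Proof.
move=> hl hs; apply: (poly_ext (fun a => esym (eqn_leq _ _))).
by apply: poly_andb; apply: poly_size_leq.
Qed.

(** Lists whose only purpose is their length: they serve as clocks and as
    measures of the tables of a structure. *)
Fixpoint power_list U (l : seq U) (k : nat) : seq unit :=
  if k is k'.+1 then flatten [seq power_list l k' | _ <- l] else [:: tt].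

Lemma size_power_list U (l : seq U) k : size (power_list l k) = size l ^ k.
Proof.
elim: k => //= k IH; rewrite size_flatten /shape -map_comp expnS.
rewrite (eq_map (g := fun=> size l ^ k)) //.
by rewrite sumnE big_map big_const_seq count_predT iter_addn_0 mulnC.
Qed.

Lemma poly_power_list (l : A -> seq S) k : poly l ->
  poly (fun a => power_list (l a) k).
Proof.
move=> hl; elim: k => [|k IH] /=; first exact: poly_const.
apply: poly_flatten; apply: (poly_map (h := fun a _ => power_list (l a) k)) => //.
exact: (poly_comp IH poly_fst).
Qed.
End Sizes.

(** Positions are written in unary because equality of lengths is decided by
    [poly_size_eq]. *)
Definition indices T (u : seq T) : seq (seq unit) :=
  [seq nseq j tt | j <- iota 0 (size u)].

Lemma poly_indices (A T : codedType) (u : A -> seq T) : poly u ->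
  poly (fun a => indices (u a)).
Proof.
move=> hu.
pose h (p : seq unit * seq (seq unit)) (_ : T) := (tt :: p.1, p.1 :: p.2).
have E (s : seq T) : foldl h ([::], [::]) s = (nseq (size s) tt, rev (indices s)).
  elim/last_ind: s => // s x IH; rewrite foldl_rcons IH /h /= size_rcons.
  congr (_, _); rewrite /indices size_rcons -addn1 iotaD map_cat rev_cat /=.
  by rewrite add0n.
suff H : poly (fun a => foldl h ([::], [::]) (u a)).
  by apply: (poly_ext _ (poly_rev (poly_snd_of H))) => a; rewrite E revK.
apply: (poly_foldl (h := fun _ => h)
   (B := fun a => (2 * sz (u a) + 1) + (sz (u a) * (2 * sz (u a) + 2) + 1) + 1)); poly.
    by rewrite /h; poly.
  by bounds; apply: poly_size.
move=> a s1 s2 e; rewrite E sz_pair sz_rev.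
have hn n : sz (nseq n tt) = 2 * n + 1.
  elim: n => // n IH; rewrite -[nseq n.+1 tt]/(tt :: nseq n tt) sz_cons IH.
  by have -> : sz tt = 1 by []; lia.
have hs : size s1 <= sz (u a).
  by apply: leq_trans (ltnW (size_sz _)); rewrite e size_cat leq_addr.
rewrite -addn1 leq_add2r; apply: leq_add; first by rewrite hn leq_add2r leq_mul2l hs orbT.
rewrite /indices.
have H (l : seq nat) : all (fun j => j <= sz (u a)) l ->
    sz [seq nseq j tt | j <- l] <= size l * (2 * sz (u a) + 2) + 1.
  elim: l => // j l IH /andP [hj /IH {}IH]; rewrite map_cons sz_cons hn.
  by rewrite [size _]/= mulSn; lia.
apply: leq_trans (H _ _) _.
  by apply/allP => j; rewrite mem_iota => /andP [_ hj]; lia.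
by rewrite size_iota leq_add2r leq_mul2r hs orbT.
Qed.

(** Sequential transducers, used for the propagation of a carry and for prefixes
    cut off at a letter. Their output is never longer than the input already
    read, which bounds the intermediate states. *)
Lemma poly_transducer (A T : codedType) (h : bool * word -> T -> bool * word)
    (l : A -> seq T) :
  poly (fun q : bool * word * T => h q.1 q.2) -> poly l ->
  (forall p x, size (h p x).2 <= (size p.2).+1) ->
  poly (fun a => foldl h (true, [::]) (l a)).
Proof.
move=> hh hl hs.
apply: (poly_foldl (h := fun _ => h) (B := fun a => sz (l a) * 4 + 5)) => //; poly.
- exact: (poly_comp (f := fun q : A * (bool * word) * T => (q.1.2, q.2)) hh
    ltac:(poly)).
- by bounds; apply: poly_size.
- move=> a s1 s2 ->.
  have H p m : size (foldl h p m).2 <= size p.2 + size m.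
    elim: m p => [|x m IH] p /=; first by rewrite addn0.
    by apply: leq_trans (IH _) _; have := hs p x; lia.
  move: (H (true, [::]) s1); case: (foldl _ _ _) => b v /=; rewrite sz_pair.
  have h1 : size s1 < sz (s1 ++ s2).
    by apply: leq_ltn_trans (size_sz _); rewrite size_cat leq_addr.
  move=> h2; have := leq_add (sz_bool b) (sz_word v).
  by move: h1 h2; move: (sz (s1 ++ s2)) (size s1) (sz b + sz v) (size v); lia.
Qed.

(** * Machines simulated by polynomial-time functions *)

#[warnings="-redundant-canonical-projection"]
Canonical coded_fin (X : finType) :=
  @Coded X (fun x => code (nseq (enum_rank x) tt)).
#[warnings="-redundant-canonical-projection"]
Canonical coded_symbol (X : finType) :=
  @Coded (symbol X) (fun x => @code (coded_fin (symbol X : finType)) x).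

(** A finite argument is read by successive tests on its unary rank, and each case
    has its own program. *)
Lemma poly_fin (X : finType) (A B : codedType) (F : X -> A -> B) :
  (forall x, poly (F x)) -> poly (fun q : coded_fin X * A => F q.1 q.2).
Proof.
move=> hF; have H n (G : nat -> A -> B) : (forall k, poly (G k)) ->
  exists2 H : seq unit * A -> B, poly H &
    forall u a, size u <= n -> H (u, a) = G (size u) a.
  elim: n G => [|n IH] G hG.
    by exists (fun q => G 0 q.2) => [|[] //]; apply: (poly_comp (hG 0) poly_snd).
  have [H hH eH] := IH (fun k => G k.+1) (fun k => hG k.+1).
  exists (fun q => if q.1 is x :: s then H (s, q.2) else G 0 q.2).
    apply: (poly_match (l := fun q : seq unit * A => q.1) (f := fun q => G 0 q.2)
      (g := fun q => H (q.2.2, q.1.2))); first exact: poly_fst.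
      exact: (poly_comp (hG 0) poly_snd).
    by apply: (poly_comp (f := fun q : seq unit * A * (unit * seq unit) => (q.2.2, q.1.2)) hH); poly.
  by case=> [|x u] a //= hu; apply: eH.
case: (pickP X) => [x0 _|X0]; last first.
  exists (Do Main Erase), (fun=> 0); split; first by exists 0.
  by case=> x; move: (X0 x).
have [H' hH eH] := H #|X| (fun k => F (nth x0 (enum X) k)) (fun k => hF _).
apply: (poly_recode (i := fun q : coded_fin X * A => (nseq (enum_rank q.1) tt, q.2))
   _ _ hH) => // [[x a]].
rewrite eH size_nseq; last exact: ltnW (ltn_ord _).
by rewrite -[nth _ _ _](enum_val_nth x0) enum_rankK.
Qed.

Lemma poly_fin_fun (X : finType) (A B : codedType) (F : X -> B) (f : A -> coded_fin X) :
  poly f -> poly (fun a => F (f a)).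
Proof.
move=> hf; have := @poly_fin X _ B (fun x (_ : unit) => F x) (fun x => poly_const _).
move=> h; apply: (poly_comp (f := fun a => (f a, tt)) h).
by poly.
Qed.

(** Case distinction on lists of a fixed length, such as the list of symbols
    scanned on the tapes of a machine. *)
Lemma poly_fin_seq (X : finType) (A B : codedType) (k : nat)
    (F : seq X -> A -> B) :
  (forall s, poly (F s)) ->
  exists2 H : seq (coded_fin X) * A -> B, poly H &
    forall s a, size s = k -> H (s, a) = F s a.
Proof.
elim: k F => [|k IH] F hF.
  exists (fun q => F [::] q.2); first exact: (poly_comp (hF _) poly_snd).
  by case.
have /fin_all_exists [H hH] : forall x, exists H : seq (coded_fin X) * A -> B,
    poly H /\ forall s a, size s = k -> H (s, a) = F (x :: s) a.
  by move=> x; have [H h1 h2] := IH (fun s => F (x :: s)) (fun s => hF _); exists H.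
exists (fun q => if q.1 is x :: s then H x (s, q.2) else F [::] q.2).
  apply: (poly_match (l := fun q : seq (coded_fin X) * A => q.1) (f := fun q => F [::] q.2)
      (g := fun q => H q.2.1 (q.2.2, q.1.2))); first exact: poly_fst.
    exact: (poly_comp (hF _) poly_snd).
  have := poly_fin (fun x => proj1 (hH x)).
  by move=> h; apply: (poly_comp (f := fun q : (seq (coded_fin X) * A) * (coded_fin X * seq (coded_fin X)) =>
       (q.2.1, (q.2.2, q.1.2))) h); poly.
by case=> [//|x s] a /= [hs]; apply: (proj2 (hH x)).
Qed.

#[warnings="-redundant-canonical-projection"]
Canonical coded_tape (X : finType) :=
  @Coded (tape X) (fun t => code (cells_left t, cells_right t)).

Definition tapes_of (M : machine) (c : config M) : seq (tape (aux M)) :=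
  [seq ctapes c i | i <- enum (tape_index M)].

#[warnings="-redundant-canonical-projection"]
Canonical coded_config (M : machine) :=
  @Coded (config M) (fun c => code (cstate c, tapes_of c)).

Section Tapes.
Variable X : finType.

Lemma poly_cells_left : poly (fun t : tape X => cells_left t).
Proof. exact: (poly_recode (i := fun t : tape X => (cells_left t, cells_right t)) _ _ poly_fst). Qed.

Lemma poly_cells_right : poly (fun t : tape X => cells_right t).
Proof. exact: (poly_recode (i := fun t : tape X => (cells_left t, cells_right t)) _ _ poly_snd). Qed.

Lemma poly_Tape (A : codedType) (f g : A -> seq (symbol X)) :
  poly f -> poly g -> poly (fun a => Tape (f a) (g a)).
Proof.
by move=> hf hg; apply: (poly_recode (i := id) _ _ (poly_pair hf hg)).
Qed.

Lemma poly_scan : poly (fun t : tape X => scan t).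
Proof. exact: poly_head poly_cells_right. Qed.

Lemma poly_update (a : symbol X) (m : move) : poly (update a m).
Proof.
have hl := poly_cells_left; have hr := poly_behead poly_cells_right.
case: m => [[]|]; apply: poly_Tape; poly.
- exact: poly_behead.
- exact: poly_head.
Qed.
End Tapes.

Section Simulation.
Variable M : machine.

(** Halted configurations are left unchanged, so that a machine may be run for
    longer than it needs. *)
Definition next_config (c : config M) : config M :=
  if [pick a in actions c] is Some a then
    Config a.1 [ffun i => update (a.2 i).1 (a.2 i).2 (ctapes c i)]
  else c.

Fixpoint update_all (l : seq (symbol (aux M) * move)) (ts : seq (tape (aux M))) :=
  match l, ts with
  | o :: l', t :: ts' => update o.1 o.2 t :: update_all l' ts'
  | _, _ => [::]
  end.

Lemma poly_update_all l : poly (update_all l).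
Proof.
elim: l => [|o l IH] /=; first by apply: (poly_ext _ (poly_const [::])); case.
apply: (poly_ext _ (poly_match (l := id) (f := fun=> [::])
  (g := fun q => update o.1 o.2 q.2.1 :: update_all l q.2.2) _ _ _)); poly.
- by case.
- by apply: (poly_comp (poly_update _ _)); poly.
- by apply: (poly_comp IH); poly.
Qed.

Lemma poly_next_config : poly next_config.
Proof.
pose I := tape_index M.
pose sc (s : seq (symbol (aux M))) : {ffun I -> symbol (aux M)} :=
  [ffun i => nth None s (enum_rank i)].
pose F (q : state M) s (p : state M * seq (tape (aux M))) :=
  if [pick a in trans q (sc s)] is Some a then
    (a.1, update_all [seq a.2 i | i <- enum I] p.2) else p.
have hF q s : poly (F q s).
  rewrite /F; case: pickP => [a _|_]; last exact: poly_id.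
  by apply: poly_pair; poly; apply: (poly_comp (poly_update_all _) poly_snd).
have hex q : exists H, poly H /\ forall s p, size s = #|I| -> H (s, p) = F q s p.
  by have [H h1 h2] := poly_fin_seq #|I| (hF q); exists H.
have [H hH] := fin_all_exists hex.
pose D (c : config M) := (cstate c, tapes_of c).
have hD : poly D by apply: (poly_recode (i := D) _ _ poly_id).
pose G (c : config M) :=
  H (cstate c) ([seq scan t | t <- tapes_of c], (cstate c, tapes_of c)).
have hG : poly G.
  have h := poly_fin (fun q => proj1 (hH q)).
  apply: (poly_comp (f := fun c => (cstate c, ([seq scan t | t <- tapes_of c],
     (cstate c, tapes_of c)))) h).
  have h1 : poly (fun c : config M => cstate c) := poly_fst_of hD.
  have h2 : poly (fun c : config M => tapes_of c) := poly_snd_of hD.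
  poly; apply: (poly_map (h := fun _ t => scan t)) => //.
  exact: (poly_comp (@poly_scan _) poly_snd).
apply: (poly_recode (i := id) _ _ hG) => // c.
suff -> : G c = D (next_config c) by [].
rewrite /G (proj2 (hH _)); last by rewrite /tapes_of ?size_map cardT ?enumT.
have Esc : sc [seq scan t | t <- tapes_of c] = scanned c.
  apply/ffunP => i; rewrite !ffunE /tapes_of -map_comp (nth_map i) -?cardE //.
  by rewrite /= -[nth _ _ _](enum_val_nth i) enum_rankK.
rewrite /F Esc /next_config /D -/(actions c); case: pickP => [a _|_] //=.
congr (_, _); rewrite /tapes_of; elim: (enum _) => //= i l ->.
by rewrite ffunE.
Qed.

Definition fin_bound (X : finType) := 2 * #|X| + 1.

Lemma sz_fin (X : finType) (x : coded_fin X) : sz x <= fin_bound X.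
Proof.
rewrite /fin_bound; have : enum_rank x < #|X| by [].
have -> : sz x = sz (nseq (enum_rank x) tt) by [].
move: (nat_of_ord _) => n hn; apply: (@leq_trans (2 * n + 1)); last by lia.
by elim: n {hn} => // n IH; rewrite -[nseq n.+1 tt]/(tt :: nseq n tt) sz_cons; have -> : sz tt = 1 by []; lia.
Qed.

Definition cells X (t : tape X) := size (cells_left t) + size (cells_right t).

Lemma cells_update X (t : tape X) a m : cells (update a m t) <= cells t + 2.
Proof. by case: t m => l r [[]|]; rewrite /cells /= ?size_behead; lia. Qed.

Definition symbol_bound := (fin_bound (symbol (aux M) : finType)).+1.

Lemma sz_tape (t : tape (aux M)) : sz t <= cells t * symbol_bound + 3.
Proof.
have -> : sz t = sz (cells_left t, cells_right t) by [].
rewrite sz_pair /cells mulnDl.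
have h (s : seq (symbol (aux M))) : sz s <= size s * symbol_bound + 1.
  by apply: sz_seq => x; apply: sz_fin.
by have := h (cells_left t); have := h (cells_right t); lia.
Qed.

Definition config_bound m :=
  fin_bound (state M) + #|tape_index M| * (m * symbol_bound + 4) + 2.

Lemma sz_config (c : config M) m : (forall i, cells (ctapes c i) <= m) ->
  sz c <= config_bound m.
Proof.
move=> hm; have -> : sz c = sz (cstate c, tapes_of c) by [].
rewrite sz_pair /config_bound /tapes_of cardE.
have h : sz [seq ctapes c i | i <- enum (tape_index M)] <=
   size (enum (tape_index M)) * (m * symbol_bound + 4) + 1.
  elim: (enum _) => //= i l IH; rewrite sz_cons mulSn.
  have := sz_tape (ctapes c i).
  have : cells (ctapes c i) * symbol_bound <= m * symbol_bound by rewrite leq_mul2r hm orbT.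
  by lia.
by apply: leq_ltn_trans (leq_add (sz_fin (cstate c)) h) _; rewrite addnA -addnS.
Qed.

Lemma cells_next c i : cells (ctapes (next_config c) i) <= cells (ctapes c i) + 2.
Proof.
rewrite /next_config; case: pickP => [a _|_]; last by lia.
by rewrite ffunE cells_update.
Qed.

Lemma run_iter n c d : deterministic M -> run n c d -> halted d ->
  forall N, n <= N -> iter N next_config c = d.
Proof.
move=> dM; elim: n c => [|n IH] c /=.
  move=> -> hd N _; elim: N => //= N ->.
  by rewrite /next_config hd; case: pickP => // a; rewrite inE.
case=> c1 [a ha e] hr hd [|N] // hN; rewrite iterSr.
suff -> : next_config c = c1 by apply: IH.
rewrite /next_config; case: pickP => [b hb|/(_ a)]; last by rewrite ha.
rewrite e; suff -> : b = a by [].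
have /card_le1P/(_ _ ha b) := dM (cstate c) (scanned c).
by rewrite -/(actions c) hb => /esym/eqP.
Qed.

Lemma poly_init : poly (fun w : word => init M w).
Proof.
pose T (w : word) (i : tape_index M) : tape (aux M) :=
  Tape [::] (if i == io M then [seq Some (inl b) | b <- w] else [::]).
pose F (b : bool) : symbol (aux M) := Some (inl b).
have hF : poly (fun w : word => [seq F b | b <- w]).
  apply: (poly_map (h := fun _ b => F b) _ poly_id).
  apply: (poly_ext (f := fun q : word * bool => if q.2 then F true else F false)).
    by case=> w [].
  by poly.
have hT i : poly (T^~ i).
  by apply: poly_Tape; poly; rewrite /=; case: (i == io M); poly.
have H : poly (fun w : word => (start M, [seq T w i | i <- enum (tape_index M)])).
  poly; elim: (enum _) => [|j l IH] /=; poly.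
  exact: hT.
apply: (poly_recode (i := id) _ _ H) => // w.
suff -> : [seq T w i | i <- enum (tape_index M)] = tapes_of (init M w) by [].
by apply: eq_map => i; rewrite ffunE.
Qed.

Lemma poly_leading_bits : poly (@leading_bits (aux M)).
Proof.
pose F (x : symbol (aux M)) := if x is Some (inl b) then (true, b) else (false, false).
pose h (p : bool * word) x := if p.1 then
  (if (F x).1 then (true, (F x).2 :: p.2) else (false, p.2)) else p.
have E0 s u : foldl h (false, u) s = (false, u) by elim: s.
have E s u : (foldl h (true, u) s).2 = rev (leading_bits s) ++ u.
  elim: s u => //= -[[b|x]|] s IH u /=; rewrite /h /= ?E0 //.
  by rewrite IH rev_cons cat_rcons.
suff H : poly (fun s => foldl h (true, [::]) s).
  by apply: (poly_ext _ (poly_rev (poly_snd_of H))) => s; rewrite E cats0 revK.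
apply: poly_transducer; last by move=> p x; rewrite /h; case: (p.1); case: (F x).1.
  have hF (f : bool * word * symbol (aux M) -> symbol (aux M)) :
    poly f -> poly (fun q => F (f q)).
    by move=> hf; apply: (poly_fin_fun (X := symbol (aux M) : finType) F hf).
  by rewrite /h; poly; apply: hF; poly.
exact: poly_id.
Qed.

Lemma poly_output : poly (@output M).
Proof.
have hD : poly (fun c : config M => tapes_of c).
  pose D (c : config M) := (cstate c, tapes_of c).
  have h : poly D by apply: (poly_recode (i := D) _ _ poly_id).
  exact: (poly_snd_of h).
have H := poly_comp poly_leading_bits (poly_comp (@poly_cells_right _)
   (poly_nth (Tape [::] [::]) (enum_rank (io M)) hD)).
apply: (poly_ext _ H) => c; rewrite /tapes_of (nth_map (io M)) -?cardE //.
by rewrite -[nth _ _ _](enum_val_nth (io M)) enum_rankK.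
Qed.
End Simulation.

#[warnings="-redundant-canonical-projection"]
Canonical coded_problem (P : problem) :=
  @Coded (instance P) (fun x => code (encode x)).

Lemma poly_encode (P : problem) : poly (fun x : instance P => encode x).
Proof. exact: (poly_recode (i := @encode P) _ _ poly_id). Qed.

(** The machine is simulated for as many rounds as its time bound allows. A round
    adds at most two cells to each tape, so all configurations that occur have
    polynomial size. *)
Lemma poly_of_machine (P Q : problem) (f : instance P -> instance Q) :
  poly_time f -> poly f.
Proof.
case=> M [dM [c hc]].
pose clock (x : instance P) := power_list (encode x) c ++ nseq c tt.
have hclock : poly clock.
  by apply: poly_cat; [apply: poly_power_list (poly_encode P)|poly].
have Hs (x : instance P) : size (clock x) = poly_bound c (size (encode x)).
  by rewrite size_cat size_power_list size_nseq.
have E s d : foldl (fun d _ => next_config d) d s = iter (size s) (@next_config M) d.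
  by elim: s d => //= x s IH d; rewrite IH -iterS iterSr.
have H : poly (fun x => foldl (fun d (_ : unit) => next_config d) (init M (encode x)) (clock x)).
  apply: (poly_foldl (h := fun _ d _ => next_config d)
     (B := fun x => config_bound M (size (encode x) + 2 * size (clock x)))) => //.
  - exact: (poly_comp (@poly_init M) (poly_encode P)).
  - by apply: (poly_comp (@poly_next_config M)); poly.
  - apply: (bounded_le (U := fun x => config_bound M (sz x + 2 * sz (clock x)))).
      move=> x; rewrite /config_bound leq_add2r leq_add2l leq_mul2l leq_add2r leq_mul2r.
      apply/orP; right; apply/orP; right; apply: leq_add (ltnW _) _.
        exact: (size_sz (encode x)).
      by rewrite leq_mul2l; apply: ltnW (size_sz _).
    by rewrite /config_bound; bounds; apply: poly_size.
  move=> x s1 s2 e; rewrite E; apply: sz_config => i.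
  have : size s1 <= size (clock x) by rewrite e size_cat leq_addr.
  move: (size s1) => n; move: (size (clock x)) => m hn.
  apply: (@leq_trans (size (encode x) + 2 * n)); last by lia.
  elim: n {hn} => [|n IH] /=.
    by rewrite ffunE /cells /=; case: eqP => //= _; rewrite size_map; lia.
  by apply: leq_trans (cells_next _ _) _; lia.
have H' := poly_comp (@poly_output M) H.
apply: (poly_recode (i := id) _ _ H') => // x.
have [n [d [hn hr hd ho]]] := hc x.
by rewrite E (run_iter dM hr hd) ?Hs // ho.
Qed.

(** * Words as numbers *)

(** Bijective binary numeration with the least significant digit first: [false]
    and [true] are the digits 1 and 2. Every word is the numeral of exactly one
    number, so that no normal form is involved. *)
Fixpoint succ_word (w : word) : word :=
  match w with
  | [::] => [:: false]
  | false :: w' => true :: w'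
  | true :: w' => false :: succ_word w'
  end.

Definition word_of_nat (n : nat) : word := iter n succ_word [::].

Fixpoint nat_of_word (w : word) : nat :=
  if w is b :: w' then 2 * nat_of_word w' + 1 + b else 0.

Lemma nat_of_succ_word w : nat_of_word (succ_word w) = (nat_of_word w).+1.
Proof. by elim: w => [|[] w IH] //=; lia. Qed.

Lemma word_of_natK : cancel word_of_nat nat_of_word.
Proof. by elim=> //= n IH; rewrite nat_of_succ_word -/(word_of_nat n) IH. Qed.

Lemma word_of_nat_double n (b : bool) : word_of_nat (2 * n + 1 + b) = b :: word_of_nat n.
Proof.
have E m : word_of_nat m.+1 = succ_word (word_of_nat m) by [].
elim: n b => [|n IH] b; first by case: b.
have -> : 2 * n.+1 + 1 + b = (2 * n + 1 + b).+2 by lia.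
by rewrite !E IH; case: b.
Qed.

Lemma nat_of_wordK : cancel nat_of_word word_of_nat.
Proof. by elim=> // b w IH; rewrite [nat_of_word _]/= word_of_nat_double IH. Qed.

Lemma exp_size_word w : 2 ^ size w <= (nat_of_word w).+1.
Proof. by elim: w => //= b w IH; rewrite expnS; lia. Qed.

Lemma nat_of_word_lt w : (nat_of_word w).+2 <= 2 ^ (size w).+1.
Proof. by elim: w => //= b w IH; rewrite expnS; case: b; lia. Qed.

Lemma size_le_nat_of_word w : size w <= nat_of_word w.
Proof. by elim: w => //= b w IH; lia. Qed.

Definition double_word (u : word) (b : bool) : word :=
  true :: (if b then true :: (u ++ u) else u ++ u).

Lemma size_double_word u (b : bool) : size (double_word u b) = 2 * size u + 1 + b.
Proof. by case: b; rewrite /= size_cat; lia. Qed.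

(** Horner's rule, starting from the most significant digit. *)
Definition unary (w : word) : word := foldl double_word [::] (rev w).

Lemma size_unary w : size (unary w) = nat_of_word w.
Proof.
rewrite /unary; elim: w => // b w IH; rewrite rev_cons foldl_rcons.
by rewrite size_double_word IH.
Qed.

Lemma poly_succ_word : poly succ_word.
Proof.
pose h (p : bool * word) (b : bool) :=
  if p.1 then (b, ~~ b :: p.2) else (false, b :: p.2).
have E0 w u : foldl h (false, u) w = (false, rev w ++ u).
  by elim: w u => //= b w IH u; rewrite /h /= IH rev_cons cat_rcons.
pose out (p : bool * word) := rev (if p.1 then false :: p.2 else p.2).
have E w u : out (foldl h (true, u) w) = rev u ++ succ_word w.
  elim: w u => [|[] w IH] u; first by rewrite /out /= rev_cons -cats1.
    by rewrite /= IH rev_cons cat_rcons.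
  by rewrite /= {2}/h /= E0 /out /= rev_cat revK rev_cons cat_rcons.
suff H : poly (fun w => foldl h (true, [::]) w).
  apply: (poly_ext (f := fun w => out (foldl h (true, [::]) w))) => [w|]; first exact: E.
  by apply: poly_rev; poly.
apply: poly_transducer; last by move=> p x; rewrite /h; case: (p.1).
  by apply: poly_if; poly; apply: poly_negb; poly.
exact: poly_id.
Qed.

Lemma poly_word_of_nat : poly (fun u : word => word_of_nat (size u)).
Proof.
have E (s d : word) : foldl (fun d _ => succ_word d) d s = iter (size s) succ_word d :> word.
  by elim: s d => //= x s IH d; rewrite IH -iterS iterSr.
apply: (poly_ext (f := fun u : word => foldl (fun d _ => succ_word d) [::] u)) => [u|].
  exact: E.
apply: (poly_foldl (h := fun _ d _ => succ_word d) (B := fun w => sz w * 4 + 5)); poly.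
- by apply: (poly_comp poly_succ_word); poly.
- by bounds.
- move=> w s1 s2 ->; rewrite E.
  apply: leq_trans (sz_word _) _.
  have h1 : size s1 < sz (s1 ++ s2).
    by apply: leq_ltn_trans (size_sz _); rewrite size_cat leq_addr.
  have h2 := size_le_nat_of_word (word_of_nat (size s1)); rewrite word_of_natK in h2.
  by rewrite leq_add // leq_mul // (leq_trans h2) // ltnW.
Qed.

Lemma poly_double_word : poly (fun q : word * bool => double_word q.1 q.2).
Proof.
have h : poly (fun q : word * bool => q.1 ++ q.1) by apply: poly_cat; poly.
by rewrite /double_word; poly.
Qed.

(** Codes of lists are written from their end, hence the detour through a
    register, which reverses the word. *)
Definition load : prog :=
  Seq (While Main nonempty (If Main is_true_bit
        (Seq (pop Main) (push RegA true)) (Seq (pop Main) (push RegA false))))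
  (Seq (push Main false)
  (While RegA nonempty (If RegA is_true_bit
     (Seq (pop RegA) (write [:: true; true; false; false]))
     (Seq (pop RegA) (write [:: true; false]))))).

Lemma enc_cons (b : bool) (w : word) : enc (b :: w) =
  tokens (if b then [:: true; true; false; false] else [:: true; false]) ++ enc w.
Proof. by rewrite /enc flat_node; case: b => /=; rewrite ?flat_node ?flat_leaf. Qed.

Lemma loadP w : runs load (on_main (tokens w)) (on_main (enc w)) (18 * size w + 5).
Proof.
apply: (@runs_le _ _ _ ((5 * size w + 1) + (2 + (12 * size w + 1)))); first by lia.
apply: (@runs_seq _ _ _ (Store [::] (tokens (rev w)) [::] [::])).
  suff H u : runs (While Main nonempty (If Main is_true_bit
        (Seq (pop Main) (push RegA true)) (Seq (pop Main) (push RegA false))))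
      (Store (tokens w) (tokens u) [::] [::])
      (Store [::] (tokens (rev w ++ u)) [::] [::]) (5 * size w + 1).
    by have := H [::]; rewrite cats0.
  elim: w u => [|b w IH] u; first exact: runs_stop.
  apply: (@runs_le _ _ _ (4 + (5 * size w + 1)).+1); first by rewrite /=; lia.
  apply: (@runs_loop _ _ _ _ (Store (tokens w) (tokens (b :: u)) [::] [::])) => //.
    apply: (@runs_if _ _ _ _ _ _ 3).
    by case: b; apply: (@runs_seq _ _ _ _ _ 1 2);
      [exact: (runs_do Main Erase (Store _ _ _ _)) | exact: (runs_push RegA _ (Store _ _ _ _))
      |exact: (runs_do Main Erase (Store _ _ _ _)) | exact: (runs_push RegA _ (Store _ _ _ _))].
  by rewrite rev_cons cat_rcons; apply: IH.
apply: runs_seq; first exact: (runs_push Main false (Store _ _ _ _)).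
rewrite -[in on_main _](cats0 w) -[X in enc (X ++ _)]revK -(size_rev w).
rewrite /= (_ : [:: Some false] = enc ([::] : word)) //.
elim: (rev w) ([::] : word) => [|b v IH] u; first exact: runs_stop.
apply: (@runs_le _ _ _ (11 + (12 * size v + 1)).+1); first by rewrite /=; lia.
apply: (@runs_loop _ _ _ _ (Store (enc (b :: u)) (tokens v) [::] [::])) => //; last first.
  by rewrite rev_cons cat_rcons; apply: IH.
apply: (@runs_if _ _ _ _ _ _ 10); rewrite enc_cons.
case: b; [apply: (@runs_le _ _ _ (1 + 9))|apply: (@runs_le _ _ _ (1 + 5))] => //.
all: apply: runs_seq; first exact: (runs_do RegA Erase (Store _ _ _ _)).
  exact: (@writeP [:: true; true; false; false] (enc u) (tokens v) [::]).
exact: (@writeP [:: true; false] (enc u) (tokens v) [::]).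
Qed.

Definition unload : prog :=
  Seq (While Main is_true_bit (Seq (pop Main) (If Main is_true_bit
       (Seq (pop Main) (Seq (pop Main) (Seq (pop Main) (push RegA true))))
       (Seq (pop Main) (push RegA false)))))
  (Seq (pop Main) (pour RegA)).

Lemma unloadP w : runs unload (on_main (enc w)) (on_main (tokens w)) (13 * size w + 3).
Proof.
apply: (@runs_le _ _ _ ((8 * size w + 1) + (1 + (5 * size (rev w) + 1)))).
  by rewrite size_rev; lia.
apply: (@runs_seq _ _ _ (Store (enc ([::] : word)) (tokens (rev w)) [::] [::])).
  suff H u : runs (While Main is_true_bit (Seq (pop Main) (If Main is_true_bit
       (Seq (pop Main) (Seq (pop Main) (Seq (pop Main) (push RegA true))))
       (Seq (pop Main) (push RegA false)))))
      (Store (enc w) (tokens u) [::] [::])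
      (Store (enc ([::] : word)) (tokens (rev w ++ u)) [::] [::]) (8 * size w + 1).
    by have := H [::]; rewrite cats0.
  elim: w u => [|b w IH] u; first exact: runs_stop.
  apply: (@runs_le _ _ _ (7 + (8 * size w + 1)).+1); first by rewrite /=; lia.
  rewrite enc_cons.
  apply: (@runs_loop _ _ _ _ (Store (enc w) (tokens (b :: u)) [::] [::])) => //.
  - by case: (b).
  - apply: (@runs_seq _ _ _ _ _ 1 6); first exact: (runs_do Main Erase (Store _ _ _ _)).
    apply: (@runs_if _ _ _ _ _ _ 5); case: b => /=.
      apply: (@runs_seq _ _ _ _ _ 1 4); first exact: (runs_do Main Erase (Store _ _ _ _)).
      apply: (@runs_seq _ _ _ _ _ 1 3); first exact: (runs_do Main Erase (Store _ _ _ _)).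
      apply: (@runs_seq _ _ _ _ _ 1 2); first exact: (runs_do Main Erase (Store _ _ _ _)).
      exact: (runs_push RegA _ (Store _ _ _ _)).
    apply: (@runs_le _ _ _ (1 + 2)) => //.
    apply: (@runs_seq _ _ _ _ _ 1 2); first exact: (runs_do Main Erase (Store _ _ _ _)).
    exact: (runs_push RegA _ (Store _ _ _ _)).
  - by rewrite rev_cons cat_rcons; apply: IH.
apply: runs_seq; first exact: (runs_do Main Erase (Store _ _ _ _)).
have := @pourP RegA (rev w) (Store [::] (tokens (rev w)) [::] [::]).
by rewrite /= revK cats0; apply.
Qed.

Lemma runs_computes (f : word -> word) p T w : computes p f T ->
  runs (Seq load (Seq p unload)) (on_main (tokens w)) (on_main (tokens (f w)))
    ((18 * size w + 5) + (T w + (13 * size (f w) + 3))).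
Proof.
move=> /(_ w [::]); rewrite !cats0 => hp.
apply: runs_seq; first exact: loadP.
by apply: runs_seq hp _; apply: unloadP.
Qed.

(** * Tally languages and exponential time *)

(** For [n] at least 2 the base [n + 2] is at most the square of [n]; the remaining
    two values of [n] are covered by the additive constant. *)
Lemma pbound_poly_bound c n : pbound c n <= poly_bound (2 * c + 3 ^ c) n.
Proof.
rewrite /pbound /poly_bound; case: (leqP n 1) => hn.
  have : (n + 2) ^ c <= 3 ^ c by case: c => // c; rewrite leq_exp2r //; lia.
  by move: (n ^ _); lia.
apply: leq_trans (leq_addr _ _).
apply: (@leq_trans (n ^ (2 * c))); last by apply: leq_pexp2l; lia.
by rewrite expnM; case: c => // c; rewrite leq_exp2r // expnS expn1; nia.
Qed.

Definition total_time (f : word -> word) (T : word -> nat) (w : word) : nat :=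
  (18 * size w + 5) + (T w + (13 * size (f w) + 3)).

(** A word numbered by the length [m] of the input has at most log(m + 1) letters,
    so that time 2^O(n) in its length is polynomial in [m]. *)
Lemma tally_in_NP (L : language) :
  in_NE L -> in_NP (fun u => L (word_of_nat (size u))).
Proof.
case=> c [N hN].
have [p [T [hT hp]]] := poly_word_of_nat.
pose f (u : word) := word_of_nat (size u).
have [d hd] : bounded (A := coded_seq coded_bool) (total_time f T).
  apply: (bounded_le (U := fun w => (18 * sz w + 5) + (T w + (13 * sz (f w) + 3)))).
    move=> w; apply: leq_add; last apply: leq_add => //.
      by rewrite leq_add2r leq_mul2l; apply: ltnW (size_sz w).
    by rewrite leq_add2r leq_mul2l; apply: ltnW (size_sz (f w)).
  by bounds; apply: poly_size poly_word_of_nat.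
have [e he] : exists e, forall w : word,
    pbound d (size w * 4 + 1) + exp_bound c (size (f w)) <= pbound e (size w).
  (* A word of length n has a code of size at most 4 n + 1, and
     4 n + 3 <= (n + 2) ^ 5. *)
  exists ((5 * d) + (c + c)).+1 => w.
  apply: leq_trans (pbound_add _ _ _); apply: leq_add.
    rewrite /pbound expnM; case: (d) => // d'; rewrite leq_exp2r //.
    have -> : (size w + 2) ^ 5 = (size w + 2) * (size w + 2) * (size w + 2) ^ 3 by rewrite !expnS expn0; lia.
    have : 8 <= (size w + 2) ^ 3 by rewrite (@leq_exp2r 2 _ 3) //; lia.
    by nia.
  rewrite -pbound_mul /exp_bound /pbound expnD; apply: leq_mul; last first.
    by case: (c) => // c'; rewrite leq_exp2r // leq_addl.
  rewrite mulnC expnM; case: (c) => // c'; rewrite leq_exp2r //.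
  by apply: leq_trans (exp_size_word _) _; rewrite /f word_of_natK; lia.
exists (2 * e + 3 ^ e), (prog_then (Seq load (Seq p unload)) N).
apply: (@prog_then_decides _ _ f (fun n => pbound d (n * 4 + 1))) hN _ _.
  move=> w; have [n hn hr] := runs_computes w hp; exists n => //.
  apply: leq_trans hn _; apply: leq_trans (hd w) _; apply: pbound_mono.
  exact: sz_word.
by move=> w; apply: leq_trans (he w) (pbound_poly_bound _ _).
Qed.

Definition read_bit_trans (q : option bool) (s : {ffun unit -> symbol void}) :
    {set option bool * {ffun unit -> symbol void * move}} :=
  if q is None then [set (Some (s tt == Some (inl true)), [ffun i => (s i, None)])]
  else set0.

Definition read_bit : machine := {|
  state := option bool;
  aux := void;
  tape_index := unit;
  io := tt;
  start := None;
  accepting := pred1 (Some true);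
  trans := read_bit_trans
|}.

Lemma read_bit_deterministic : deterministic read_bit.
Proof. by case=> [b|] s; rewrite /= ?cards0 ?cards1. Qed.

Lemma read_bit_decides :
  decides_in_time read_bit (fun=> 1) (fun w => head false w).
Proof.
move=> w.
have hs : scanned (init read_bit w) tt == Some (inl true) = head false w.
  by rewrite !ffunE /=; case: w => [|[] w].
have hh (c : config read_bit) (b : bool) : cstate c = Some b -> halted c.
  by move=> e; rewrite /halted /actions e.
have step1 (c : config read_bit) :
    step (init read_bit w) c -> cstate c = Some (head false w).
  by case=> a; rewrite /actions /= => /set1P -> ->; rewrite /= hs.
split.
  case=> [|[|n]] c //= [c1 /step1 /hh h1] [c2 /(halted_step h1)] //.
split=> [hw|[[|n] [c [/= hr hc ha]]]].
- exists 1; eexists; split.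
  + eexists; last by [].
    by eexists; [apply: set11|reflexivity].
  + by apply: hh => /=; reflexivity.
  + by rewrite /= hs hw.
- by move: ha; rewrite -hr.
- case: hr => c1 /step1 h1; case: n => [|n] /=.
    by move=> h; move: ha; rewrite /= -h h1 => /eqP [].
  by case=> c2 /(halted_step (hh _ _ h1)).
Qed.

(** Words measured by their value: what is polynomial in this size is 2^O(n) in
    the length of the word. *)
Definition coded_tally := @Coded word (fun w => code (unary w)).

Lemma computes_unary : exists p T, bounded (A := coded_tally) T /\
  computes (A := coded_seq coded_bool) (B := coded_seq coded_bool) p unary T.
Proof.
have [p [U [[d hd] hp]]] : poly (fun q : (bool * word) * word =>
   (q.1.2, double_word q.2 q.1.1)).
  by poly; apply: (poly_comp (f := fun q => (q.2, q.1.1)) poly_double_word); poly.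
have [q [V [[e he] hq]]] : poly (fun w : word => (rev w, [::] : word)).
  by poly; apply: poly_rev; poly.
(* During the loop neither the remaining digits nor the tally built so far are
   longer than the final tally. *)
pose b (w : word) := pbound d (16 * sz (unary w) + 16).
exists (Seq q (list_loop p)), (fun w => pbound e (4 * sz (unary w) + 1) +
   (sz (unary w) * (b w + 4) + 3)).
have hsz w : size w < sz (unary w).
  by apply: leq_ltn_trans (size_sz _); rewrite size_unary size_le_nat_of_word.
split.
  by rewrite /b; bounds; exists 1 => w; rewrite /pbound expn1 leq_addr.
move=> w r; apply: runs_seq.
  apply: runs_le (hq w r); apply: leq_trans (he w) _; apply: pbound_mono.
  by apply: leq_trans (sz_word _) _; have := hsz w; lia.
apply: (@runs_le _ _ _ (size (rev w) * (b w + 4) + 3)).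
  by rewrite leq_add2r leq_mul2r size_rev ltnW ?orbT.
apply: (runs_foldl hp) => s1 x s2 E; apply: leq_trans (hd _) _; apply: pbound_mono.
have h1 : size s2 <= sz (unary w).
  apply: leq_trans (ltnW (hsz w)); rewrite -(size_rev w) E size_cat /=; lia.
have h2 : size (foldl double_word [::] s1) <= sz (unary w).
  apply: leq_trans (ltnW (size_sz _)); rewrite /unary E foldl_cat.
  elim: (_ :: _) (foldl _ _ s1) => //= y s IH u.
  by apply: leq_trans (IH _); rewrite size_double_word; lia.
rewrite !sz_pair; have h3 := sz_word s2; have h4 := sz_word (foldl double_word [::] s1).
have h5 := sz_bool x.
move: h1 h2 h3 h4 h5; move: (sz (foldl _ _ _)) (sz s2) (size s2) (size (foldl _ _ _)) (sz x).
by lia.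
Qed.

(** The word is expanded into a tally, on which [h] runs in polynomial time. *)
Lemma in_E_of_poly (h : word -> bool) (L : language) : poly h ->
  (forall u, h u <-> L (word_of_nat (size u))) -> in_E L.
Proof.
move=> hh hL.
pose f (w : word) : word := [:: h (unary w)].
have [p1 [T1 [hT1 hp1]]] := computes_unary.
have [p2 [T2 [[c2 hT2] hp2]]] : poly (fun u => [:: h u]) by poly.
have hp : computes (A := coded_seq coded_bool) (B := coded_seq coded_bool)
  (Seq p1 p2) f (fun w => T1 w + T2 (unary w)) := computes_comp hp1 hp2.
have [k hk] : bounded (A := coded_tally) (total_time f (fun w => T1 w + T2 (unary w))).
  apply: (bounded_le (U := fun w : coded_tally =>
     (18 * sz w + 5) + ((T1 w + pbound c2 (sz w)) + 16))); last by bounds.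
  move=> w; apply: leq_add; last by apply: leq_add => //; rewrite leq_add2l; apply: hT2.
  rewrite leq_add2r leq_mul2l; apply: leq_trans (size_le_nat_of_word w) _.
  by rewrite -size_unary; apply: ltnW (size_sz (unary w)).
(* The code of the tally of a word of length n has size at most 4 * 2 ^ (n + 1),
   and 4 * 2 ^ (n + 1) + 2 <= 2 ^ (n + 5). *)
exists (5 * k + 5 + 1), (prog_then (Seq load (Seq (Seq p1 p2) unload)) read_bit).
  exact: prog_then_deterministic read_bit_deterministic.
have hN := @prog_then_decides (Seq load (Seq (Seq p1 p2) unload)) read_bit f
  (fun n => pbound k (4 * 2 ^ n.+1)) (fun=> 1) (fun w => head false w).
have {}hN : forall T' : nat -> nat,
  (forall w : word, pbound k (4 * 2 ^ (size w).+1) + 1 <= T' (size w)) ->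
  decides_in_time (prog_then (Seq load (Seq (Seq p1 p2) unload)) read_bit) T'
     (fun w => head false (f w)).
  apply: hN; last exact: read_bit_decides.
  move=> w; have [n hn hr] := runs_computes w hp; exists n => //.
  apply: leq_trans hn _; apply: leq_trans (hk w) _; apply: pbound_mono.
  have -> : sz (w : coded_tally) = sz (unary w) by [].
  apply: leq_trans (sz_word _) _; rewrite size_unary.
  by have := nat_of_word_lt w; lia.
have hL' w : L w <-> head false (f w).
  by rewrite /= -[w in L w]nat_of_wordK -size_unary; split=> /hL.
have {}hN : decides_in_time (prog_then (Seq load (Seq (Seq p1 p2) unload)) read_bit)
    (exp_bound (5 * k + 5 + 1)) (fun w => head false (f w)).
  apply: hN => w; rewrite /pbound /exp_bound.
  apply: (@leq_trans (2 ^ (5 * k + k * size w) + 2 ^ (5 * k + k * size w))).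
    apply: leq_add; last by rewrite expn_gt0.
    have -> : 5 * k + k * size w = (size w + 5) * k by lia.
    rewrite expnM; case: (k) => // k'; rewrite leq_exp2r // expnD expnS (_ : 2 ^ 5 = 32) //.
    have h2 : 0 < 2 ^ size w by rewrite expn_gt0.
    by move: (2 ^ size w) h2; lia.
  by rewrite addnn -mul2n -expnS leq_exp2l //; lia.
by move=> w; have [h1 h2] := hN w; split=> //; rewrite hL'.
Qed.

(** * Structures read off their encodings *)

Lemma mem_all_tuples (T : finType) k (t : k.-tuple T) : t \in all_tuples T k.
Proof.
elim: k t => [|k IH] t; first by rewrite tuple0 inE.
case/tupleP: t => x t /=; apply/allpairsP; exists (x, t); split => //=.
by rewrite mem_enum.
Qed.

Lemma size_all_tuples (T : finType) k : size (all_tuples T k) = #|T| ^ k.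
Proof. by elim: k => //= k IH; rewrite size_allpairs IH expnS cardE. Qed.

(** [tensor] multiplies characteristic vectors: it describes a product of sets of
    elements among the tuples in lexicographic order, which is the order of the
    tables of a structure. *)
Definition outer (a b : word) : word := [seq x && y | x <- a, y <- b].
Definition tensor (vs : seq word) : word := foldr outer [:: true] vs.

Lemma tensorE (T : finType) I (P : I -> T -> bool) (l : seq I) k : size l = k ->
  tensor [seq [seq P i x | x <- enum T] | i <- l] =
  [seq all2 P l (tval t) | t <- all_tuples T k].
Proof.
elim: l k => [|i l IH] [|k] //= [hl].
rewrite (IH k hl) /outer map_allpairs; elim: (enum T) => //= x s ->.
by rewrite -map_comp.
Qed.

Lemma val_enum_sig (T : finType) (S : {set T}) :
  map val (enum {: {x : T | x \in S}}) = [seq x <- enum T | x \in S].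
Proof.
have -> : enum {: {x : T | x \in S}} = pmap insub (enum T).
  by rewrite [LHS]enumT [X in _ = pmap _ X]enumT [in LHS]unlock.
rewrite pmap_filter; last exact: insubK.
by apply: eq_filter => x; apply: isSome_insub.
Qed.

Lemma filter_allpairs S T U (p : pred S) (q : pred T) (r : pred U)
    (f : S -> T -> U) (s : seq S) (t : seq T) :
  (forall x y, r (f x y) = p x && q y) ->
  [seq z <- [seq f x y | x <- s, y <- t] | r z] =
  [seq f x y | x <- [seq x <- s | p x], y <- [seq y <- t | q y]].
Proof.
move=> h; elim: s => //= x s IH; rewrite filter_cat IH filter_map.
have -> : [seq y <- t | preim (f x) r y] = if p x then [seq y <- t | q y] else [::].
  by elim: t {IH} => [|y t /= ->]; rewrite ?h; case: (p x).
by case: (p x).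
Qed.

Lemma all_tuples_sig (T : finType) (S : {set T}) k :
  [seq map_tuple val t | t <- all_tuples {: {x : T | x \in S}} k] =
  [seq t : k.-tuple T <- all_tuples T k | all (mem S) t].
Proof.
elim: k => [|k IH] /=; first by congr [:: _]; apply: val_inj.
rewrite (filter_allpairs (p := mem S) (q := fun t : k.-tuple T => all (mem S) t)) //.
rewrite -IH -val_enum_sig map_allpairs; elim: (enum _) => //= x s ->.
congr (_ ++ _); rewrite -map_comp; apply: eq_map => t.
exact: val_inj.
Qed.

(** Both uses of tables are selections by a characteristic vector: looking up a
    tuple selects one entry, and removing an element selects the tuples that
    avoid it. *)
Lemma mask_map2 T U (f : T -> bool) (g : T -> U) (s : seq T) :
  mask (map f s) (map g s) = map g (filter f s).
Proof. by rewrite -map_mask -filter_mask. Qed.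

#[warnings="-redundant-canonical-projection"]
Canonical coded_structure (tau : signature) :=
  @Coded (structure tau) (fun A => code (encode_structure A)).

Section Structures.
Variable tau : signature.
Implicit Types A B : structure tau.

Definition table A (R : tau) : word := [seq interp t | t <- all_tuples A (arity R)].
Definition tables A : seq word := [seq table A R | R <- enum tau].
Definition universe A : word := nseq #|A| true.

Lemma encodeE A : encode_structure A = universe A ++ false :: flatten (tables A).
Proof. by []. Qed.

Lemma poly_encode_structure : poly (fun A : structure tau => encode_structure A).
Proof. exact: (poly_recode (i := @encode_structure tau) _ _ poly_id). Qed.

Definition leading_ones (w : word) : word :=
  (foldl (fun (p : bool * word) b =>
     if p.1 then (if b then (true, true :: p.2) else (false, p.2)) else p)
     (true, [::]) w).2.

Lemma leading_onesE n w : leading_ones (nseq n true ++ false :: w) = nseq n true.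
Proof.
rewrite /leading_ones foldl_cat /=; set h := (fun _ _ => _).
have E0 u : foldl h (false, u) w = (false, u) by elim: w.
have -> : forall u, foldl h (true, u) (nseq n true) = (true, nseq n true ++ u).
  elim: n => //= n IH u; rewrite IH -cat_cons -cat1s catA.
  by rewrite cats1 -[in rcons _ _](rev_nseq n) -rev_cons (rev_nseq n.+1).
by rewrite /= E0 cats0.
Qed.

Lemma poly_leading_ones : poly leading_ones.
Proof.
pose h (p : bool * word) (b : bool) :=
  if p.1 then (if b then (true, true :: p.2) else (false, p.2)) else p.
suff H : poly (fun w => foldl h (true, [::]) w) by exact: (poly_snd_of H).
apply: poly_transducer; last by move=> [[] w] [].
  by rewrite /h; poly.
exact: poly_id.
Qed.

Lemma poly_universe : poly universe.
Proof.
apply: (poly_ext _ (poly_comp poly_leading_ones poly_encode_structure)) => A.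
exact: leading_onesE.
Qed.

(** Cuts the concatenated tables at the lengths given by the arities [ks] and the
    size of the domain, the length of [u]. *)
Fixpoint chunks (ks : seq nat) (u : word) (s : word) : seq word :=
  if ks is k :: ks' then
    let p := split_at (power_list u k) s in p.1 :: chunks ks' u p.2
  else [::].

Lemma poly_chunks ks (A : codedType) (u s : A -> word) : poly u -> poly s ->
  poly (fun a => chunks ks (u a) (s a)).
Proof.
move=> hu; elim: ks s => [|k ks IH] s hs /=; first exact: poly_const.
have h := poly_split_at (poly_power_list k hu) hs.
by apply: poly_cons; [exact: poly_fst_of h | exact: IH (poly_snd_of h)].
Qed.

Lemma chunks_tables A (rs : seq tau) :
  chunks [seq arity R | R <- rs] (universe A) (flatten [seq table A R | R <- rs]) =
  [seq table A R | R <- rs].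
Proof.
elim: rs => //= R rs IH.
have e : size (power_list (universe A) (arity R)) = size (table A R).
  by rewrite size_power_list size_nseq size_map size_all_tuples.
by rewrite e take_size_cat // drop_size_cat // IH.
Qed.

Lemma poly_tables : poly tables.
Proof.
have h1 : poly (fun A => behead (split_at (universe A) (encode_structure A)).2).
  apply: poly_behead; apply: poly_snd_of.
  exact: poly_split_at poly_universe poly_encode_structure.
apply: (poly_ext _ (poly_chunks [seq arity R | R <- enum tau] poly_universe h1)) => A.
by rewrite encodeE /split_at drop_size_cat //= chunks_tables.
Qed.

(** Elements are handled through their characteristic vectors, from which the
    vectors of single tuples and of complements are obtained by [tensor]. *)
Definition point A (a : A) : word := [seq x == a | x <- enum A].
Definition points A : seq word := [seq point a | a <- enum A].

(** The enumeration of the domain is isomorphic to the list of positions, and the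
    latter is available from the size alone. *)
Lemma poly_points : poly points.
Proof.
pose D A := indices (universe A).
have hD : poly D := poly_indices poly_universe.
have H : poly (fun A => [seq [seq size i == size j | i <- D A] | j <- D A]).
  apply: (poly_map (h := fun A j => [seq size i == size j | i <- D A])) => //.
  apply: (poly_map (h := fun (q : structure tau * seq unit) i => size i == size q.2)).
    by apply: poly_size_eq; poly.
  exact: (poly_comp hD poly_fst).
apply: (poly_ext _ H) => A.
have [x0 _] : exists x0 : A, x0 \in A by apply/card_gt0P; apply: domain_nonempty.
have [f hf E] : exists2 f : nat -> A,
    (forall i j, i < #|A| -> j < #|A| -> (f i == f j) = (i == j)) &
    enum A = [seq f i | i <- iota 0 #|A|].
  exists (nth x0 (enum A)); last by rewrite cardE -/(mkseq _ _) mkseq_nth.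
  by move=> i j hi hj; rewrite nth_uniq -?cardE ?enum_uniq.
rewrite /D /points /point /indices size_nseq {}E -!map_comp.
apply/eq_in_map => j; rewrite mem_iota => /andP [_ hj] /=.
rewrite -!map_comp; apply/eq_in_map => i; rewrite mem_iota => /andP [_ hi] /=.
by rewrite !size_nseq hf.
Qed.
End Structures.

(** * Model checking and removal of an element *)

Lemma poly_outer (A : codedType) (u v : A -> word) : poly u -> poly v ->
  poly (fun a => outer (u a) (v a)).
Proof.
move=> hu hv; apply: poly_flatten.
apply: (poly_map (h := fun a x => [seq x && y | y <- v a])) => //.
apply: (poly_map (h := fun (q : A * bool) y => q.2 && y)).
  by apply: poly_andb; poly.
exact: (poly_comp hv poly_fst).
Qed.

Lemma poly_tensor (A : codedType) I (u : I -> A -> word) (l : seq I) :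
  (forall i, poly (u i)) -> poly (fun a => tensor [seq u i a | i <- l]).
Proof.
move=> hu; elim: l => [|i l IH]; first exact: poly_const.
exact: poly_outer.
Qed.

Section Model_checking.
Variable tau : signature.
Implicit Types A B : structure tau.

Definition context := (seq word * seq word)%type.
Definition context_of A : context := (points A, tables A).

(** The first component of [c] lists the points over which quantifiers range, the
    second one the tables; [t] lists the points assigned to the variables. *)
Fixpoint eval n (phi : formula tau n) (c : context) (t : seq word) : bool :=
  match phi with
  | FFalse _ => false
  | FEq _ i j => has id (mask (nth [::] t i) (nth [::] t j))
  | FRel _ R v => has id (mask (tensor [seq nth [::] t (nat_of_ord i) | i <- tval v])
                               (nth [::] c.2 (enum_rank R)))
  | FNot _ psi => ~~ eval psi c t
  | FAnd _ psi chi => eval psi c t && eval chi c t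
  | FOr _ psi chi => eval psi c t || eval chi c t
  | FEx _ psi => has (fun x => eval psi c (x :: t)) c.1
  | FAll _ psi => all (fun x => eval psi c (x :: t)) c.1
  end.

Lemma poly_has_id (A : codedType) (w : A -> word) : poly w ->
  poly (fun a => has id (w a)).
Proof. by move=> hw; apply: (poly_has (h := fun _ b => b)); poly. Qed.

Lemma poly_eval n (phi : formula tau n) :
  poly (fun q : context * seq word => eval phi q.1 q.2).
Proof.
elim: phi => {n} /= [n|n i j|n R v|n psi IH|n psi IH1 chi IH2|n psi IH1 chi IH2|
  n psi IH|n psi IH].
- exact: poly_const.
- by apply: poly_has_id; apply: poly_mask; apply: poly_nth; poly.
- apply: poly_has_id; apply: poly_mask; last by apply: poly_nth; poly.
  apply: (poly_tensor (u := fun (i : 'I_n) (q : context * seq word) => nth [::] q.2 i)) => i.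
  by apply: poly_nth; poly.
- exact: poly_negb.
- exact: poly_andb.
- exact: poly_orb.
- apply: (poly_has (h := fun (q : context * seq word) x => eval psi q.1 (x :: q.2))); poly.
  by apply: (poly_comp (f := fun q : context * seq word * word => (q.1.1, q.2 :: q.1.2)) IH); poly.
- apply: (poly_all (h := fun (q : context * seq word) x => eval psi q.1 (x :: q.2))); poly.
  by apply: (poly_comp (f := fun q : context * seq word * word => (q.1.1, q.2 :: q.1.2)) IH); poly.
Qed.

Lemma evalP A n (phi : formula tau n) (e : 'I_n -> A) t :
  (forall i : 'I_n, nth [::] t i = point (e i)) ->
  eval phi (context_of A) t = sat phi e.
Proof.
elim: phi e t => {n} /= [n|n i j|n R v|n psi IH|n psi IH1 chi IH2|n psi IH1 chi IH2|
  n psi IH|n psi IH] e t ht //.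
- rewrite !ht /point mask_map2 has_map; apply/hasP/eqP => [[x]|e_ij].
    by rewrite mem_filter => /andP [/eqP <- _] /= /eqP.
  exists (e j); last exact/eqP.
  by rewrite mem_filter mem_enum andbT; apply/eqP.
- have -> : [seq nth [::] t (nat_of_ord i) | i <- v] =
     [seq [seq x == a | x <- enum A] | a <- [seq e i | i <- v]].
    by rewrite -map_comp; apply: eq_map => i; apply: ht.
  rewrite /tables (nth_map R) -?cardE //.
  rewrite -[nth R _ _](enum_val_nth R) enum_rankK /table.
  rewrite (@tensorE A A (fun a x => x == a) _ (arity R)); last first.
    by rewrite size_map size_tuple.
  rewrite mask_map2 has_map.
  have E (s : (arity R).-tuple A) :
      all2 (fun a x => x == a) [seq e i | i <- v] s = (s == map_tuple e v).
    rewrite -val_eqE /=; elim: [seq e i | i <- v] (tval s) => [|a l IH] [|x s'] //=.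
    by rewrite IH.
  rewrite (eq_filter E); apply/idP/idP.
    by case/hasP => s; rewrite mem_filter => /andP [/eqP -> _].
  by move=> h; apply/hasP; exists (map_tuple e v) => //; rewrite mem_filter eqxx mem_all_tuples.
- by rewrite (IH e).
- by rewrite (IH1 e) // (IH2 e).
- by rewrite (IH1 e) // (IH2 e).
- have E x : eval psi (context_of A) (point x :: t) = sat psi (extend x e).
    by apply: IH => i; rewrite /extend; case: unliftP => [j|] -> //=; rewrite ht.
  rewrite has_map; apply/hasP/existsP => [[x _ /=]|[x hx]]; first by rewrite E; exists x.
  by exists x; rewrite ?mem_enum //= E.
- have E x : eval psi (context_of A) (point x :: t) = sat psi (extend x e).
    by apply: IH => i; rewrite /extend; case: unliftP => [j|] -> //=; rewrite ht.
  rewrite all_map; apply/allP/forallP => [h x|h x _ /=]; last by rewrite E.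
  by rewrite -E; apply: (h x); rewrite mem_enum.
Qed.

Definition check (phi : sentence tau) A : bool := eval phi (context_of A) [::].

Lemma checkP phi A : reflect (models A phi) (check phi A).
Proof.
apply: (iffP idP) => [h e|h]; first by rewrite -(@evalP A 0 phi e [::]) //; case.
have e : 'I_0 -> A by case.
by rewrite /check (@evalP A 0 phi e) //; case.
Qed.

Lemma poly_check phi : poly (check phi).
Proof.
apply: (poly_comp (f := fun A => (context_of A, [::])) (poly_eval phi)).
by rewrite /context_of; poly; [apply: poly_points|apply: poly_tables].
Qed.
End Model_checking.

Section Removal.
Variable tau : signature.
Implicit Types A B : structure tau.

(** Structures are nonempty, so the only element of a structure is not removed;
    [children] is empty in this case. *)
Definition remove A (a : A) : structure tau :=
  oapp (fun S : {S : {set A} | S != set0} => substructure (valP S)) A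
    (insub [set~ a]).

Definition children A : seq (structure tau) :=
  if 1 < #|A| then [seq remove a | a <- enum A] else [::].

Lemma removeE A (a : A) : 1 < #|A| ->
  exists h : [set~ a] != set0, remove a = substructure h.
Proof.
move=> hA; have h : [set~ a] != set0 by rewrite -card_gt0 cardsC1; case: #|A| hA => [|[]].
by rewrite /remove (insubT (fun S : {set A} => S != set0) h) /=; eexists.
Qed.

Lemma card_substructure A (S : {set A}) (h : S != set0) :
  #|substructure h| = #|S|.
Proof. by rewrite /= card_sig; apply: eq_card. Qed.

Lemma card_remove A (a : A) : 1 < #|A| -> #|remove a| = #|A|.-1.
Proof. by move=> /(removeE a) [h ->]; rewrite card_substructure cardsC1. Qed.

Fixpoint restrict (ks : seq nat) (m : word) (ts : seq word) : seq word :=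
  match ks, ts with
  | k :: ks', t :: ts' => mask (tensor (nseq k m)) t :: restrict ks' m ts'
  | _, _ => [::]
  end.

Lemma poly_restrict (A : codedType) ks (m : A -> word) (ts : A -> seq word) :
  poly m -> poly ts -> poly (fun a => restrict ks (m a) (ts a)).
Proof.
move=> hm hts.
suff H : poly (fun q : word * seq word => restrict ks q.1 q.2).
  by apply: (poly_comp (f := fun a => (m a, ts a)) H); poly.
elim: ks => [|k ks IH]; first by apply: (poly_ext _ (poly_const [::])).
apply: (poly_ext _ (poly_match (l := fun q : word * seq word => q.2) (f := fun=> [::])
  (g := fun q => mask (tensor (nseq k q.1.1)) q.2.1 :: restrict ks q.1.1 q.2.2) _ _ _)); poly.
- by case=> u [].
- apply: poly_mask; poly.
  apply: (poly_ext (f := fun q : word * seq word * (word * seq word) =>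
     tensor [seq (fun _ => q.1.1) i | i <- nseq k tt])).
    by move=> q; rewrite map_nseq.
  apply: (poly_tensor (u := fun (_ : unit) (q : word * seq word * (word * seq word)) => q.1.1)).
  by move=> _; poly.
- by apply: (poly_comp (f := fun q : word * seq word * (word * seq word) => (q.1.1, q.2.2)) IH); poly.
Qed.

Lemma restrict_tables A (S : {set A}) (h : S != set0) (rs : seq tau) :
  restrict [seq arity R | R <- rs] [seq x \in S | x <- enum A]
     [seq table A R | R <- rs] = [seq table (substructure h) R | R <- rs].
Proof.
elim: rs => //= R rs ->; congr (_ :: _).
have -> : nseq (arity R) [seq x \in S | x <- enum A] =
    [seq [seq (fun _ x => x \in S) i x | x <- enum A] | i <- nseq (arity R) tt].
  by rewrite map_nseq.
rewrite (@tensorE A unit (fun _ x => x \in S) _ (arity R)) ?size_nseq //.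
rewrite /table mask_map2.
have E (t : (arity R).-tuple A) :
    all2 (fun _ x => x \in S) (nseq (arity R) tt) t = all (mem S) t.
  by case: t => s /= /eqP <-; elim: s => //= x s ->.
by rewrite (eq_filter E) -all_tuples_sig -map_comp.
Qed.

Definition remove_code (u : word) (ts : seq word) (p : word) : word :=
  behead u ++ false :: flatten (restrict [seq arity R | R <- enum tau]
    [seq ~~ b | b <- p] ts).

Lemma encode_remove A (a : A) : 1 < #|A| ->
  encode_structure (remove a) = remove_code (universe A) (tables A) (point a).
Proof.
move=> hA; rewrite encodeE /remove_code /universe card_remove //.
have -> : behead (nseq #|A| true) = nseq #|A|.-1 true by case: #|A|.
have -> : [seq ~~ b | b <- point a] = [seq x \in [set~ a] | x <- enum A].
  by rewrite /point -map_comp; apply: eq_map => x; rewrite /= !inE.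
have [h ->] := removeE a hA.
by rewrite (restrict_tables h).
Qed.

Lemma poly_children : poly children.
Proof.
have hu := poly_universe tau; have ht := poly_tables tau; have hp := poly_points tau.
have H : poly (fun A => if nilp (behead (universe A)) then [::] else
    [seq remove_code (universe A) (tables A) p | p <- points A]).
  apply: poly_if; first by apply: poly_nilp; apply: poly_behead.
    exact: poly_const.
  apply: (poly_map (h := fun A p => remove_code (universe A) (tables A) p)) => //.
  have h1 : poly (fun q : structure tau * word => universe q.1) := poly_comp hu poly_fst.
  have h2 : poly (fun q : structure tau * word => tables q.1) := poly_comp ht poly_fst.
  apply: poly_cat; first exact: poly_behead.
  apply: poly_cons; first exact: poly_const.
  apply: poly_flatten; apply: poly_restrict => //.
  by apply: (poly_map (h := fun _ b => ~~ b)); [apply: poly_negb|]; poly.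
apply: (poly_recode (i := id) _ _ H) => // A.
rewrite /children /universe.
have -> : nilp (behead (nseq #|A| true)) = ~~ (1 < #|A|).
  by case: #|A| (domain_nonempty A) => [|[]].
case: ifP => //= hA; rewrite /points -map_comp.
elim: (enum A) => //= a l ->; congr Node.
by rewrite -encode_remove.
Qed.

Lemma size_encode A : size (encode_structure A) =
  #|A| + (\sum_(R <- enum tau) #|A| ^ arity R).+1.
Proof.
rewrite encodeE size_cat size_nseq /= size_flatten /shape -!map_comp.
rewrite sumnE big_map; congr (_ + _.+1); rewrite [enum tau]enumT; apply: eq_bigr => R _ /=.
by rewrite size_map size_all_tuples.
Qed.

Lemma size_encode_le A B : #|A| <= #|B| ->
  size (encode_structure A) <= size (encode_structure B).
Proof.
move=> h; rewrite !size_encode leq_add // ltnS; apply: leq_sum => R _.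
by case: (arity R) => // k; rewrite leq_exp2r.
Qed.
End Removal.

(** * Removal of an element and hereditary satisfaction *)

Section Isomorphism.
Variable tau : signature.
Implicit Types A B : structure tau.

Lemma sat_iso A B (h : A -> B) : injective h -> (forall y, exists x, y = h x) ->
  (forall R (t : (arity R).-tuple A), interp (map_tuple h t) = interp t) ->
  forall n (phi : formula tau n) e e', (forall i, e' i = h (e i)) ->
  sat phi e' = sat phi e.
Proof.
move=> inj_h surj_h interp_h n; elim => {n} /= [n|n i j|n R v|n psi IH|
  n psi IH1 chi IH2|n psi IH1 chi IH2|n psi IH|n psi IH] e e' he //.
- by rewrite !he inj_eq.
- rewrite -interp_h; congr interp; apply: val_inj => /=.
  by rewrite -map_comp; apply: eq_map.
- by rewrite (IH e).
- by rewrite (IH1 e) // (IH2 e).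
- by rewrite (IH1 e) // (IH2 e).
- have E x : sat psi (extend (h x) e') = sat psi (extend x e).
    by apply: IH => i; rewrite /extend; case: unliftP => [j|] _ /=.
  apply/existsP/existsP => [[y]|[x]]; last by exists (h x); rewrite E.
  by have [x ->] := surj_h y; rewrite E => hx; exists x.
- have E x : sat psi (extend (h x) e') = sat psi (extend x e).
    by apply: IH => i; rewrite /extend; case: unliftP => [j|] _ /=.
  apply/forallP/forallP => [H x|H y]; first by rewrite -E.
  by have [x ->] := surj_h y; rewrite E.
Qed.

(** An embedding is an isomorphism onto the substructure on its range. All
    comparisons of substructures below are instances of this. *)
Lemma models_image A B (j : B -> A) (S : {set A}) (hS : S != set0)
    (phi : sentence tau) :
  injective j -> (forall R (t : (arity R).-tuple B), interp (map_tuple j t) = interp t) ->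
  (forall a, a \in S <-> exists b, a = j b) ->
  models B phi <-> models (substructure hS) phi.
Proof.
move=> inj_j interp_j jS.
have hj b : j b \in S by apply/jS; exists b.
pose h (b : B) : substructure hS := exist _ (j b) (hj b).
have H (e : 'I_0 -> B) (e' : 'I_0 -> substructure hS) : sat phi e' = sat phi e.
  apply: (@sat_iso _ _ h) => [x y [/inj_j //]|[a ha]|R t|[]//].
    by have [b e0] := (proj1 (jS a)) ha; exists b; apply: val_inj.
  by rewrite -interp_j /=; congr interp; apply: val_inj; rewrite /= -map_comp.
split=> hm e.
  have [e' _] : exists e' : 'I_0 -> B, True by eexists=> //; case.
  by rewrite (H e' e).
by rewrite -(H e (fun i => h (e i))).
Qed.

Lemma models_nested A (S : {set A}) (hS : S != set0)
    (S' : {set substructure hS}) (hS' : S' != set0) (U : {set A}) (hU : U != set0)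
    (phi : sentence tau) : U = [set val x | x in S'] ->
  models (substructure hS') phi <-> models (substructure hU) phi.
Proof.
move=> eU.
apply: (@models_image A (substructure hS') (fun x => val (val x))).
- by move=> x y /val_inj/val_inj.
- by move=> R t /=; congr interp; apply: val_inj; rewrite /= -map_comp.
- move=> a; rewrite eU; split=> [/imsetP [x hx ->]|[x ->]].
    by exists (exist _ x hx).
  by apply: imset_f; apply: valP.
Qed.

(** A substructure on a proper subset avoids some element [a], so it is a
    substructure of [remove a] up to isomorphism. *)
Lemma hereditarily_models_step (phi : sentence tau) A :
  hereditarily_models phi A <->
  models A phi /\ (1 < #|A| -> forall a : A, hereditarily_models phi (remove a)).
Proof.
have hT (hS : [set: A] != set0) : models A phi <-> models (substructure hS) phi.
  apply: (@models_image _ _ id) => //.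
    by move=> R t; congr interp; apply: val_inj; rewrite /= map_id.
  by move=> a; split=> _; [exists a|rewrite inE].
have [x0 _] : exists x0 : A, x0 \in A by apply/card_gt0P; apply: domain_nonempty.
split=> [hA|[hA hR] S hS].
  split.
    have hS : [set: A] != set0 by apply/set0Pn; exists x0.
    exact/(hT hS)/hA.
  move=> hc a; have [h ->] := removeE a hc.
  move=> S' hS'; have hU : [set val x | x in S'] != set0.
    by rewrite imset_eq0.
  exact/(models_nested hS' hU)/hA.
have [eS|neS] := eqVneq S setT; first by subst S; exact/hT.
have [a aS] : exists a, a \notin S.
  by apply/existsP; rewrite -negb_forall; apply: contra neS => /forallP h; apply/eqP/setP => x; rewrite h inE.
have [b bS] := set0Pn _ hS.
have ab : b != a by apply: contraNneq aS => <-.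
have hc : 1 < #|A|.
  by have := subset_leq_card (subsetT [set a; b]); rewrite cardsT cards2 eq_sym ab.
have := hR hc a; have [h ->] := removeE a hc => {}hR.
pose S' : {set substructure h} := [set x | val x \in S].
have memC x : x \in S -> x \in [set~ a].
  by move=> xS; rewrite !inE; apply: contraNneq aS => <-.
have hS' : S' != set0.
  by apply/set0Pn; exists (exist _ b (memC b bS)); rewrite inE.
apply/(models_nested hS' hS); last exact: hR.
apply/setP => x; apply/idP/imsetP => [xS|[y]]; last by rewrite inE => yS ->.
by exists (exist _ x (memC x xS)); rewrite ?inE.
Qed.
End Isomorphism.

(** * Search with pruning *)

(** Structures have no decidable equality, which membership in a list would
    require. *)
Fixpoint every T (P : T -> Prop) (s : seq T) : Prop :=
  if s is x :: s' then P x /\ every P s' else True.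

Lemma every_cat T (P : T -> Prop) s t : every P (s ++ t) <-> every P s /\ every P t.
Proof. by elim: s => /= [|x s ->]; tauto. Qed.

Lemma every_imp T (P Q : T -> Prop) s : (forall x, P x -> Q x) -> every P s -> every Q s.
Proof. by move=> h; elim: s => //= x s IH [/h hx /IH]. Qed.

(** Only the length of [key] matters: two structures with keys of the same length
    are interchangeable, and one of them is kept. *)
Section Pruning.
Variable tau : signature.
Implicit Types (A B : structure tau) (l : seq (structure tau)).
Variable key : structure tau -> word.
Hypothesis poly_key : poly key.

Definition insert l B :=
  if has (fun C => size (key C) == size (key B)) l then l else B :: l.

Definition prune l := foldl insert [::] l.

Lemma sz_prune acc l : sz (foldl insert acc l) <= sz acc + sz l.
Proof.
elim: l acc => [|B l IH] acc /=; first exact: leq_addr.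
apply: leq_trans (IH _) _; rewrite [sz (B :: l)]sz_cons /insert.
by case: ifP => _; rewrite ?[sz (B :: acc)]sz_cons; lia.
Qed.

Lemma poly_prune : poly prune.
Proof.
apply: (poly_foldl (h := fun _ => insert) (B := fun l => sz l + 1)); poly.
- rewrite /insert; apply: poly_if; poly.
  apply: (poly_has (h := fun (q : seq (structure tau) * seq (structure tau) * structure tau) C =>
     size (key C) == size (key q.2))); poly.
  apply: poly_size_eq; first exact: poly_comp poly_key poly_snd.
  by apply: (poly_comp poly_key); poly.
- by bounds.
- move=> l s1 s2 ->; apply: leq_trans (sz_prune _ _) _.
  by rewrite addnC sz_nil leq_add2r sz_prefix.
Qed.

Lemma every_prune (P : structure tau -> Prop) l :
  (forall B C, size (key B) = size (key C) -> P B -> P C) ->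
  every P (prune l) <-> every P l.
Proof.
move=> hP; suff H acc : every P (foldl insert acc l) <-> every P acc /\ every P l.
  by rewrite /prune H /=; tauto.
elim: l acc => [|B l IH] acc /=; first by tauto.
rewrite IH /insert; case: ifP => h /=; last by tauto.
suff hB : every P acc -> P B by tauto.
elim: acc h => //= C acc IHa /orP [/eqP e [hC _]|/IHa h [_ /h //]].
exact: hP e hC.
Qed.

Lemma every_prune_sub (P : structure tau -> Prop) l : every P l -> every P (prune l).
Proof.
suff H acc : every P acc /\ every P l -> every P (foldl insert acc l).
  by move=> h; apply: H.
elim: l acc => [|B l IH] acc /= [ha] //= [hB hl].
by apply: IH; split=> //; rewrite /insert; case: ifP.
Qed.

(** The kept structures have keys of distinct lengths. *)
Lemma size_prune l m : every (fun B => size (key B) < m) l -> size (prune l) <= m.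
Proof.
move=> hl; have ha := every_prune_sub hl.
suff hu : uniq [seq size (key B) | B <- prune l].
  rewrite -(size_map (fun B => size (key B))) -(size_iota 0 m).
  apply: uniq_leq_size hu _ => x; elim: (prune l) ha => //= B s IH [hB /IH {}IH].
  by rewrite inE => /orP [/eqP ->|/IH //]; rewrite mem_iota.
suff H acc : uniq [seq size (key B) | B <- acc] ->
   uniq [seq size (key B) | B <- foldl insert acc l] by apply: H.
elim: l {hl ha} acc => [|B l IH] acc //= ha; apply: IH; rewrite /insert.
case: ifP => //= hB; rewrite ha andbT; move/negbT: hB; apply: contra.
elim: acc {ha} => //= C acc IHa; rewrite inE => /orP [/eqP ->|/IHa ->].
  by rewrite eqxx.
by rewrite orbT.
Qed.

Variable phi : sentence tau.
Hypothesis key_her : forall B C, size (key B) = size (key C) ->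
  hereditarily_models phi B -> hereditarily_models phi C.

(** One level of the search: the flag records whether all structures met so far
    satisfy the sentence. *)
Definition search_step (st : bool * seq (structure tau)) :=
  (st.1 && all (check phi) st.2, prune (flatten [seq children B | B <- st.2])).

Definition search A (u : word) :=
  foldl (fun st _ => search_step st) (true, [:: A]) u.

Lemma poly_search_step : poly search_step.
Proof.
apply: poly_pair.
  apply: poly_andb; poly.
  apply: (poly_all (h := fun _ B => check phi B)); poly.
  exact: (poly_comp (poly_check phi) poly_snd).
apply: (poly_comp poly_prune); apply: poly_flatten.
apply: (poly_map (h := fun _ B => children B)); poly.
exact: (poly_comp (@poly_children tau) poly_snd).
Qed.

Lemma every_children (P : structure tau -> Prop) A :
  every P (children A) <-> (1 < #|A| -> forall a : A, P (remove a)).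
Proof.
rewrite /children; case: ifP => hA; last by [].
have H : every P [seq remove a | a <- enum A] <-> forall a, a \in enum A -> P (remove a).
  elim: (enum A) => //= a s ->; split=> [[h1 h2] b|h].
    by rewrite inE => /orP [/eqP ->|/h2].
  by split=> [|b hb]; apply: h; rewrite inE ?eqxx ?hb ?orbT.
rewrite H; split=> [h _ a|h a _]; last exact: h.
by apply: h; rewrite mem_enum.
Qed.

Lemma every_flatten_children (P : structure tau -> Prop) l :
  every P (flatten [seq children B | B <- l]) <-> every (fun B => every P (children B)) l.
Proof. by elim: l => //= B l IH; rewrite every_cat IH. Qed.

Lemma search_step_correct st :
  ((search_step st).1 /\ every (hereditarily_models phi) (search_step st).2) <->
  (st.1 /\ every (hereditarily_models phi) st.2).
Proof.
case: st => b l; rewrite /search_step /= every_prune // every_flatten_children.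
elim: l => /= [|B l IH]; first by rewrite andbT.
rewrite hereditarily_models_step -every_children.
case: b IH => /= IH; last by split=> -[].
case: checkP => hB /=; last by split=> [[]|[_ [[/hB]]]].
by have t : true := isT; tauto.
Qed.

Lemma searchE A u x : search A (rcons u x) = search_step (search A u).
Proof. by rewrite /search foldl_rcons. Qed.

(** The conjunction of the flag and the hereditary satisfaction of the frontier is
    invariant. *)
Lemma search_correct A u :
  ((search A u).1 /\ every (hereditarily_models phi) (search A u).2) <->
  hereditarily_models phi A.
Proof.
elim/last_ind: u => [|u x IH]; first by split=> [[_ []]|].
by rewrite searchE search_step_correct.
Qed.

Lemma search_card A u : every (fun B => #|B| + size u <= #|A|) (search A u).2.
Proof.
elim/last_ind: u => [|u x IH]; first by rewrite /search /= addn0.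
rewrite searchE size_rcons /=; apply: every_prune_sub.
rewrite every_flatten_children; apply: every_imp IH => B hB.
apply/every_children => hc a; rewrite card_remove //.
by move: hB hc; case: #|B| => [|n] /=; rewrite ?addnS; lia.
Qed.

(** The frontier is empty after as many levels as [A] has elements, so the flag
    alone gives the answer. *)
Lemma search_complete A :
  (search A (universe A)).1 <-> hereditarily_models phi A.
Proof.
rewrite -(search_correct A (universe A)).
have := search_card A (universe A); case: (search _ _).2 => [|B l] /=; first by tauto.
rewrite size_nseq -[X in _ <= X]add0n leq_add2r leqNgt => -[h _].
by move: h; rewrite domain_nonempty.
Qed.

(** No structure in a frontier has a longer encoding than [A], so the lengths of
    their keys have a common polynomial bound [m A], which by pruning bounds
    the number of these structures. *)
Lemma poly_search : poly (fun A => (search A (universe A)).1).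
Proof.
suff H : poly (fun A => search A (universe A)) by exact: (poly_fst_of H).
have [c hc] := poly_size poly_key.
pose s A := sz A * 4 + 1.
(* s bounds the codes of the structures in all frontiers, m the number of
   possible lengths of their keys. *)
pose m A := pbound c (s A) + 1.
apply: (poly_foldl (h := fun (_ : structure tau) st _ => search_step st)
  (B := fun A => 3 + (m A * (s A + 1) + 1) + 1)).
- exact: poly_universe.
- by poly.
- by apply: (poly_comp poly_search_step); poly.
- by rewrite /m /s; bounds.
move=> A u v _; rewrite -/(search A u).
have hs : every (fun B => sz B <= s A) (search A u).2.
  apply: every_imp (search_card A u) => B hB.
  have hB' : #|B| <= #|A| by apply: leq_trans hB; apply: leq_addr.
  have -> : sz B = sz (encode_structure B) by [].
  apply: leq_trans (sz_word _) _; rewrite leq_add2r leq_mul2r /=.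
  apply: leq_trans (size_encode_le hB') _.
  exact: ltnW (size_sz (encode_structure A)).
have hm : size (search A u).2 <= m A.
  case/lastP: u hs => [|u x] hs; first by rewrite /search /= /m addn1.
  rewrite searchE /=; apply: size_prune.
  have : every (fun B => sz B <= s A) (flatten [seq children B | B <- (search A u).2]).
    rewrite every_flatten_children; apply: every_imp (search_card A u) => B hB.
    apply/every_children => hcd a.
    have hB' : #|remove a| <= #|A|.
      by rewrite card_remove // (leq_trans (leq_pred _)) // (leq_trans (leq_addr _ _) hB).
    have -> : sz (remove a) = sz (encode_structure (remove a)) by [].
    apply: leq_trans (sz_word _) _; rewrite leq_add2r leq_mul2r /=.
    apply: leq_trans (size_encode_le hB') _.
    exact: ltnW (size_sz (encode_structure A)).
  apply: every_imp => B hB; rewrite /m addn1 ltnS.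
  apply: leq_trans (ltnW (size_sz _)) _; apply: leq_trans (hc B) _.
  exact: pbound_mono.
case: (search A u) hs hm => b l /= hs hm.
rewrite sz_pair -addn1 leq_add2r leq_add ?sz_bool //.
apply: (@leq_trans (size l * (s A + 1) + 1)); last by rewrite leq_add2r leq_mul2r hm orbT.
elim: l hs {hm} => //= B l IH [hB /IH {}IH].
by rewrite sz_cons mulSn; lia.
Qed.
End Pruning.

(** * Collapse of NE to E *)

Theorem corollary4p3 :
  ~ (forall L : language, in_E L <-> in_NE L) -> ~ coNP_rich HerFO.
Proof.
move=> hE hrich; apply: hE => L; split.
  by case=> c [M dM hM]; exists c, M.
move=> hL.
pose K : language := fun u => ~ L (word_of_nat (size u)).
(* The complement of K is the set of tallies of words of L, up to a double
   negation. *)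
have hK : in_coNP K.
  have [c [N hN]] := tally_in_NP hL; exists c, N => w.
  have [h1 h2] := hN w; split=> //; rewrite -h2 /K.
  by split=> [/NNPP|h]; last by apply.
have [P [tau [phi ->]] [[f [hf eqf]] [g [hg eqg]]]] := hrich K hK.
pose key (A : structure tau) : word := g A.
have pf : poly (A := coded_seq coded_bool) (B := coded_structure tau) f.
  have := poly_of_machine hf.
  by apply: (poly_recode (i := id)).
have pg : poly (A := coded_structure tau) (B := coded_seq coded_bool) key.
  have := poly_of_machine hg.
  by apply: (poly_recode (i := id)).
have key_her B C : size (key B) = size (key C) ->
  hereditarily_models phi B -> hereditarily_models phi C.
  move=> e hB; apply: (proj2 (eqg C)); have := proj1 (eqg B) hB.
  by rewrite /= /K -/(key B) -/(key C) e.
pose h (u : word) := ~~ (search key phi (f u) (universe (f u))).1.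
apply: (@in_E_of_poly h).
  apply: poly_negb; exact: (poly_comp (poly_search pg phi) pf).
move=> u; have h1 := search_complete key_her (f u).
have h2 : K u <-> hereditarily_models phi (f u) := eqf u.
rewrite /h; split.
  by move/negP => hn; apply: NNPP => hu; apply: hn; apply/h1/h2.
by move=> hu; apply/negP => /h1/h2; apply.
Qed.
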